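(* Let $0<r\le1$, let $\psi\in\mathcal{A}_0$, and let $X$ be an r.i. space on $(0,1)$. Assume that $$\underline{\alpha}_X>\overline{\beta}_\psi.$$ Then, for measurable $f\in L^0(0,1)$, $$\left\|\frac{O(|f|^r,\cdot)^{1/r}}{\psi(\cdot)}\right\|_X+\|f\|_{L^r}\simeq\left\|\frac{((|f|^r)^{**}(\cdot))^{1/r}}{\psi(\cdot)}\right\|_X\simeq\left\|\frac{f^{**}(\cdot)}{\psi(\cdot)}\right\|_X,$$ with constants of equivalence independent of $f$. In particular, the resulting space (of those $f$ for which these quantities are finite) is independent of $r$.
   Context: $A\simeq B$ means $c^{-1}A\le B\le cA$ for some constant $c>0$ independent of the relevant functions. All function spaces are over $(0,1)$ with Lebesgue measure; $L^0=L^0(0,1)$ is the space of a.e. finite measurable functions. The decreasing rearrangement of $f$ is $f^*(s)=\inf\{t>0:|\{x\in(0,1):|f(x)|>t\}|\le s\}$, and $f^{**}(t)=\frac1t\int_0^t f^*(s)\,ds$ for $0<t<1$. For $0<r\le1$, $O(|f|^r,t):=(|f|^r)^{**}(t)-(|f|^r)^*(t)$. Also $\|f\|_{L^r}=(\int_0^1|f|^r)^{1/r}$. An r.i. space $X$ is a Banach function space on $(0,1)$ (in the sense of Bennett--Sharpley) such that $\|f\|_X=\|g\|_X$ whenever $f^*=g^*$; norms are $+\infty$ for functions not in the space. Lower Boyd index: for $s>0$ the dilation operator is $(E_sf)(t)=f(t/s)$ for $0<t<\min\{1,s\}$ and $(E_sf)(t)=0$ for $\min\{1,s\}\le t<1$;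 $h_X(s)=\|E_s\|_{X\to X}$; $\underline{\alpha}_X=\lim_{s\to0^+}\frac{\log h_X(s)}{\log s}$. Class $\mathcal{A}_0$: for a positive function $\psi$ on $(0,1)$ put $m_\psi(t)=\sup\{\psi(st)/\psi(s):0<s<1,\ st<1\}$, $t>0$. If $m_\psi(t)<\infty$ for all $t>0$, the fundamental indices of $\psi$ are $\underline{\beta}_\psi=\lim_{t\to0^+}\frac{\log m_\psi(t)}{\log t}$ and $\overline{\beta}_\psi=\lim_{t\to\infty}\frac{\log m_\psi(t)}{\log t}$. $\mathcal{A}_0$ is the class of increasing positive functions $\psi:(0,1)\to(0,\infty)$ with $m_\psi<\infty$, $\psi(0^+)=0$ and $0<\underline{\beta}_\psi\le\overline{\beta}_\psi<1$. *)

(* Defs.v *)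
From HB Require Import structures.
From mathcomp Require Import all_boot all_order all_algebra.
From mathcomp Require Import all_classical all_reals all_analysis.
From mathcomp Require Import measurable_realfun.

Set Implicit Arguments.
Unset Strict Implicit.
Unset Printing Implicit Defensive.

Import Order.TTheory GRing.Theory Num.Theory.
Import numFieldNormedType.Exports.

Local Open Scope classical_set_scope.
Local Open Scope ring_scope.

(* A function on (0,1) is encoded as a total function on R, of which only the
   values on (0,1) matter; "measurable" is Borel measurability on (0,1). *)
Definition I01 (R : realType) : set R := `]0%R, 1%R[%classic.
Arguments I01 : clear implicits.

Section FunctionSpaces.
Variable R : realType.
Implicit Types f g : R -> \bar R.
Local Notation mu := (@lebesgue_measure R).
Local Notation I := (I01 R).

Local Open Scope ereal_scope.

Definition L0 f : Prop :=
  measurable_fun I f /\ {ae mu, forall x, I x -> f x \is a fin_num}.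

Definition Mplus f : Prop :=
  measurable_fun I f /\ (forall x, I x -> 0 <= f x).

Definition rearr f (s : R) : \bar R :=
  ereal_inf [set t%:E | t in
    [set t : R | (0 < t)%R /\ mu [set x | I x /\ t%:E < `|f x|] <= s%:E]].

Definition maxrearr f (t : R) : \bar R :=
  t^-1%:E * \int[mu]_(s in `]0%R, t[) rearr f s.

Definition abspow (r : R) f (x : R) : \bar R := `|f x| `^ r.

Definition oscill (r : R) f (t : R) : \bar R :=
  maxrearr (abspow r f) t - rearr (abspow r f) t.

Definition normLr (r : R) f : \bar R :=
  (\int[mu]_(x in I) `|f x| `^ r) `^ r^-1.

(* Bennett and Sharpley's axioms (P1)-(P5) for a function norm on the cone of
   measurable functions (0,1) -> [0, +oo]. The values of rho outside of this
   cone are irrelevant. *)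
Record banach_function_norm (rho : (R -> \bar R) -> \bar R) : Prop := {
  bfn_ge0 : forall f, Mplus f -> 0 <= rho f ;
  bfn_eq0 : forall f, Mplus f ->
    rho f = 0 <-> {ae mu, forall x, I x -> f x = 0} ;
  bfnZ : forall (a : R) f, (0 <= a)%R -> Mplus f ->
    rho (fun x => a%:E * f x) = a%:E * rho f ;
  bfnD : forall f g, Mplus f -> Mplus g ->
    rho (fun x => f x + g x) <= rho f + rho g ;
  bfn_le : forall f g, Mplus f -> Mplus g ->
    {ae mu, forall x, I x -> g x <= f x} -> rho g <= rho f ;
  bfn_fatou : forall (F : nat -> R -> \bar R) f,
    (forall n, Mplus (F n)) -> Mplus f ->
    {ae mu, forall x, I x ->
      (forall n, F n x <= F n.+1 x) /\ F ^~ x @ \oo --> f x} ->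
    rho (F n) @[n --> \oo] --> rho f ;
  bfn_indic : forall E : set R, measurable E -> E `<=` I ->
    rho (fun x => (\1_E x)%:E) < +oo ;
  bfn_integral : forall E : set R, measurable E -> E `<=` I ->
    exists2 C : R, (0 < C)%R & forall f, Mplus f ->
      \int[mu]_(x in E) f x <= C%:E * rho f
}.

(* The Banach function space X generated by rho consists of the measurable f
   for which normX rho f is finite. *)
Definition normX (rho : (R -> \bar R) -> \bar R) f : \bar R :=
  rho (fun x => `|f x|).

Definition ri_norm (rho : (R -> \bar R) -> \bar R) : Prop :=
  banach_function_norm rho /\
  (forall f g, L0 f -> L0 g ->
    (forall s, I s -> rearr f s = rearr g s) -> normX rho f = normX rho g).

Definition dilation (s : R) f (t : R) : \bar R :=
  if (0 < t < Num.min 1 s)%R then f (t / s)%R else 0.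

Definition dilation_norm (rho : (R -> \bar R) -> \bar R) (s : R) : \bar R :=
  ereal_sup [set normX rho (dilation s f) | f in
    [set f | measurable_fun I f /\ normX rho f <= 1]].

(* dilation_norm rho s is always finite for a rearrangement-invariant rho. *)
Definition lower_boyd_index (rho : (R -> \bar R) -> \bar R) : R :=
  lim (ln (fine (dilation_norm rho s)) / ln s @[s --> (0 : R)^'+])%R.

Definition mfun_sup (psi : R -> R) (t : R) : \bar R :=
  ereal_sup [set (psi (s * t) / psi s)%:E | s in
    [set s : R | (0 < s < 1)%R /\ (s * t < 1)%R]].

Definition lower_fund_index (psi : R -> R) : R :=
  lim (ln (fine (mfun_sup psi t)) / ln t @[t --> (0 : R)^'+])%R.

Definition upper_fund_index (psi : R -> R) : R :=
  lim (ln (fine (mfun_sup psi t)) / ln t @[t --> (+oo)%R])%R.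

Record classA0 (psi : R -> R) : Prop := {
  A0_gt0 : forall t : R, I t -> (0 < psi t)%R ;
  A0_nondecreasing : forall s t : R, I s -> I t -> (s <= t)%R ->
    (psi s <= psi t)%R ;
  A0_fin : forall t : R, (0 < t)%R -> mfun_sup psi t < +oo ;
  A0_cvg0 : (psi t @[t --> (0 : R)^'+] --> (0 : R))%R ;
  A0_lower_gt0 : (0 < lower_fund_index psi)%R ;
  A0_lower_le_upper : (lower_fund_index psi <= upper_fund_index psi)%R ;
  A0_upper_lt1 : (upper_fund_index psi < 1)%R
}.

Definition simeq (A B : (R -> \bar R) -> \bar R) : Prop :=
  exists2 c : R, (0 < c)%R &
    forall f, L0 f -> c^-1%:E * A f <= B f /\ B f <= c%:E * A f.

Definition osc_norm (rho : (R -> \bar R) -> \bar R) (psi : R -> R) (r : R) f : \bar R :=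
  normX rho (fun t => oscill r f t `^ r^-1 * (psi t)^-1%:E) + normLr r f.

Definition max_norm (rho : (R -> \bar R) -> \bar R) (psi : R -> R) (r : R) f : \bar R :=
  normX rho (fun t => maxrearr (abspow r f) t `^ r^-1 * (psi t)^-1%:E).

Definition max_norm1 (rho : (R -> \bar R) -> \bar R) (psi : R -> R) f :=
  normX rho (fun t => maxrearr f t * (psi t)^-1%:E).

Definition finite_space (A : (R -> \bar R) -> \bar R) : set (R -> \bar R) :=
  [set f | L0 f /\ A f < +oo].

End FunctionSpaces.

(* Main.v *)
Require Import Defs.
From mathcomp Require Import all_boot all_order all_algebra.
From mathcomp Require Import all_classical all_reals all_analysis.
From mathcomp Require Import measurable_realfun.
From mathcomp Require Import ring lra.

(** Write Rh for the decreasing rearrangement of h and Mh for its maximal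
    function, the mean of Rh over (0,t). Let g = |f|^r, p = 1/r and let J be the
    integral of g over (0,1), so that the L^r norm of f is J^p.

    The proof works along one geometric scale b^k, with an integer b so large
    that the index conditions hold at every scale. As the upper index of psi is
    below the lower Boyd index, the factor sup psi (b^k t) / psi t, caused by
    moving the weight through a dilation, loses against the norm of the dilation
    by b^-k; as the lower index of psi is positive, psi decays along b^-k. Both
    facts are stated, with one ratio q < 1, in weighted_dilation_decay.

    The first equivalence. The oscillation is at most Mg, and J <= Mg, which
    give one inequality. Conversely the difference of Mg at t and b t is at most
    b - 1 times the oscillation at b t (maxrearr_step); summing over the scales
    until b^k t is close to 1, where Mg is comparable with J, bounds Mg by a sum
    of dilations of the oscillation and of J (maxrearr_le_dilation_sum). The
    power p of such a sum is at most a constant times the sum of the powers with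
    the weights q^-k (poweR_sum_le), and the dilations decay like q^(2 k), so
    that the norms can be summed (wnorm_maxrearr_le_osc). A similar summation
    shows that 1 / psi has finite norm (wnorm1_lty), which takes care of the
    constant J.

    The second equivalence. By Jensen's inequality (Mg)^p is at most a constant
    times Mf. Conversely Rf <= (Mg)^p, so it suffices to bound the norm of
    Mf / psi by that of Rf / psi, a Hardy inequality (wnorm_maxrearr_le_rearr).
    It sums the values of Rf at b^-k t with the weights b^-k; the decay of psi
    provides a factor q^k, and the stretching by b^k of the nonincreasing
    function Rf / psi costs b^k up to a constant. This last bound replaces an
    interpolation theorem and is the place where rearrangement invariance is
    used (norm_stretch_le): the stretched function is cut into b^(k+1) step
    functions, each equimeasurable with a function below Rf / psi.

    The quantity with Mf does not involve r, so the spaces do not either. *)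

Set Implicit Arguments.
Unset Strict Implicit.
Unset Printing Implicit Defensive.

Import Order.TTheory GRing.Theory Num.Theory.
Import numFieldNormedType.Exports.
Local Open Scope classical_set_scope.
Local Open Scope ring_scope.

(** * Powers, monotone functions and the layer cake formula *)

Section Preliminaries.
Variable R : realType.
Local Notation mu := (@lebesgue_measure R).
Local Open Scope ereal_scope.

(** Used with lt_rearr, to transfer identities between distribution functions
    to rearrangements. *)
Lemma eq_ge0_lt (A B : \bar R) : 0 <= A -> 0 <= B ->
  (forall lam : R, (0 <= lam)%R -> (lam%:E < A) = (lam%:E < B)) -> A = B.
Proof.
move=> A0 B0 AB; apply/eqP; rewrite eq_le.
have H (U V : \bar R) : 0 <= V -> (forall lam : R, (0 <= lam)%R ->
    (lam%:E < U) -> (lam%:E < V)) -> U <= V.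
  move=> V0 UV; rewrite leNgt; apply/negP => VU.
  have : V \is a fin_num by rewrite ge0_fin_numE// (lt_le_trans VU)// leey.
  move=> /fineK Vf; have := UV (fine V); rewrite Vf ltxx; apply/not_implyP.
  by rewrite fine_ge0//; split => //; apply/not_implyP.
by apply/andP; split; apply: H => // lam l0; rewrite AB.
Qed.

Lemma ler_poweR (p : R) (x y : \bar R) : (0 <= p)%R -> 0 <= x -> x <= y ->
  x `^ p <= y `^ p.
Proof.
move=> p0 x0 xy; apply: gt0_ler_poweR => //; rewrite in_itv/= ?x0 ?leey ?andbT//.
exact: le_trans xy.
Qed.

Lemma lt_poweR (r lam : R) (x : \bar R) : (0 < r)%R -> (0 <= lam)%R -> 0 <= x ->
  (lam%:E < x `^ r) = ((lam `^ r^-1)%:E < x).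
Proof.
move=> r0 lam0; case: x => [x| |]// x0.
- rewrite lee_fin in x0; rewrite poweR_EFin !lte_fin; apply/idP/idP => h.
  + have rV : (0 < r^-1)%R by rewrite invr_gt0.
    have := gt0_ltr_powR rV _ _ h.
    by rewrite -powRrM mulfV ?gt_eqF// powRr1//; apply; rewrite ?nnegrE ?powR_ge0.
  + have := gt0_ltr_powR r0 _ _ h.
    by rewrite -powRrM mulVf ?gt_eqF// powRr1//; apply; rewrite ?nnegrE ?powR_ge0.
- by rewrite poweRyr ?gt_eqF// !ltry.
Qed.

Lemma poweRrK (p : R) (x : \bar R) : p != 0%R -> 0 <= x -> (x `^ p) `^ p^-1 = x.
Proof. by move=> p0 x0; rewrite -poweRrM mulfV// poweRe1. Qed.

(** Stands in for the tangent inequality of the concave power: x^r <= 1 + x,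
    rescaled by c. Averaged with c close to the mean of x, it gives Jensen's
    inequality up to a factor 2. *)
Lemma poweR_le_affine (r c : R) (x : \bar R) : (0 < r <= 1)%R -> (0 < c)%R ->
  0 <= x -> x `^ r <= (c `^ r)%R%:E * (1 + c^-1%:E * x).
Proof.
move=> /andP[r0 r1] c0; case: x => [x| |]// x0; last first.
  rewrite poweRyr ?gt_eqF// gt0_muley ?lte_fin ?invr_gt0// addey//.
  by rewrite gt0_muley ?lte_fin ?powR_gt0.
rewrite lee_fin in x0; rewrite poweR_EFin -!EFinM lee_fin.
have y0 : (0 <= x / c)%R by rewrite divr_ge0// ltW.
have xE : x = (c * (x / c))%R by field; lra.
move: y0 xE; set y := (x / c)%R => y0 ->.
rewrite powRM//; last exact: ltW.
rewrite ler_wpM2l ?powR_ge0// mulKf ?gt_eqF//.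
have [y1|y1] := leP y 1%R.
  have : (y `^ r <= 1 `^ r)%R by rewrite ge0_ler_powR ?nnegrE// ltW.
  by rewrite powR1; lra.
have := ler1_powR (ltW y1) r1; lra.
Qed.

Lemma poweR_add_le (p : R) (x y : \bar R) : (0 <= p)%R -> 0 <= x -> 0 <= y ->
  (x + y) `^ p <= (2 `^ p)%R%:E * (x `^ p + y `^ p).
Proof.
move=> p0 x0 y0.
have h (u v : \bar R) : 0 <= u -> 0 <= v -> u <= v ->
    (u + v) `^ p <= (2 `^ p)%R%:E * (u `^ p + v `^ p).
  move=> u0 v0 uv; apply: (@le_trans _ _ ((2%:E * v) `^ p)).
    apply: ler_poweR => //; first exact: adde_ge0.
    by rewrite mule_natl mule2n leeD2r.
  rewrite poweRM// poweR_EFin lee_wpmul2l ?lee_fin ?powR_ge0//.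
  by rewrite leeDr// poweR_ge0.
have [xy|/ltW yx] := leP x y; first exact: h.
by rewrite addeC [X in _ * X]addeC h.
Qed.

Lemma emeasurable_nonincreasing (D : set R) (h : R -> \bar R) :
  is_interval D ->
  (forall s t, D s -> D t -> (s <= t)%R -> h t <= h s) -> measurable_fun D h.
Proof.
move=> iD nh; apply: (measurability (@ErealGenOInfty.G R)).
  exact: ErealGenOInfty.measurableE.
move=> _ [_] [r ->] <-.
apply: is_interval_measurable => s t [Ds /=].
rewrite !in_itv/= !andbT => hs [Dt ht] u.
move=> /andP[su ut]; have Du : D u by apply: (iD s t) => //; rewrite su ut.
by split => //=; rewrite in_itv/= andbT (lt_le_trans ht)// nh.
Qed.

Lemma emeasurable_nondecreasing (D : set R) (h : R -> \bar R) :
  is_interval D ->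
  (forall s t, D s -> D t -> (s <= t)%R -> h s <= h t) -> measurable_fun D h.
Proof.
move=> iD nh; apply: (measurability (@ErealGenOInfty.G R)).
  exact: ErealGenOInfty.measurableE.
move=> _ [_] [r ->] <-.
apply: is_interval_measurable => s t [Ds /=].
rewrite !in_itv/= !andbT => hs [Dt ht] u.
move=> /andP[su ut]; have Du : D u by apply: (iD s t) => //; rewrite su ut.
by split => //=; rewrite in_itv/= andbT (lt_le_trans hs)// nh.
Qed.

Lemma mu_itvco (s t : R) : (s <= t)%R -> mu `[s, t[ = (t - s)%:E.
Proof.
rewrite le_eqVlt => /predU1P[->|st]; rewrite lebesgue_measure_itv/= lte_fin.
  by rewrite ltxx subrr.
by rewrite st.
Qed.

Lemma mu_below (v : \bar R) : 0 <= v ->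
  mu [set y | (0 <= y)%R /\ y%:E < v] = v.
Proof.
case: v => [v| |]// v0.
- have -> : [set y | (0 <= y)%R /\ y%:E < v%:E] = `[0%R, v[%classic.
    by apply/seteqP; split => y /=; rewrite in_itv/= lte_fin => /andP.
  by rewrite mu_itvco// subr0.
- have -> : [set y : R | (0 <= y)%R /\ y%:E < +oo] = `[0%R, +oo[%classic.
    apply/seteqP; split => y /=; rewrite in_itv/= ?andbT; first by case.
    by rewrite ltry.
  by rewrite lebesgue_measure_itv/= ltry.
Qed.

Lemma measurable_below (v : \bar R) :
  measurable [set y : R | (0 <= y)%R /\ y%:E < v].
Proof.
apply: is_interval_measurable => s t [/= s0 sv] [t0 tv] u /andP[su ut].
by split; [exact: le_trans su|apply: le_lt_trans tv; rewrite lee_fin].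
Qed.

(** Tonelli's theorem for the indicator of the region below the graph of h. *)
Lemma layer_cake (D : set R) (h : R -> \bar R) : measurable D ->
  measurable_fun D h -> (forall x, D x -> 0 <= h x) ->
  \int[mu]_(x in D) h x =
  \int[mu]_(lam in `[0%R, +oo[) mu [set x | D x /\ lam%:E < h x].
Proof.
move=> mD mh h0; pose k := h \_ D.
have k0 x : 0 <= k x by exact: erestrict_ge0.
have mk : measurable_fun [set: R] k by exact/(measurable_restrictT _ _).1.
pose A := [set p : R * R | (0 <= p.2)%R /\ p.2%:E < k p.1].
have mA : measurable A.
  have -> : A = [set p | (0 <= p.2)%R] `&` [set p | p.2%:E < k p.1].
    by apply/seteqP; split.
  apply: measurableI.
    rewrite -[X in measurable X]setTI.
    have : measurable_fun [set: R * R] (fun p : R * R => (0 <= p.2)%R).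
      exact: measurable_fun_ler.
    by move=> /(_ measurableT [set true]); apply.
  rewrite -[X in measurable X]setTI; apply: measurable_lte => //.
    by apply/measurable_EFinP; exact: measurable_snd.
  exact: measurableT_comp.
pose ind (p : R * R) : \bar R := (\1_A p)%:E.
transitivity (\int[mu]_x \int[mu]_y ind (x, y)).
  rewrite integral_mkcond; apply: eq_integral => x _; rewrite -/(k x).
  pose S := [set y : R | (0 <= y)%R /\ y%:E < k x].
  rewrite -[LHS]mu_below// -/S.
  have -> : \int[mu]_y ind (x, y) = \int[mu]_y (\1_S y)%:E by [].
  by rewrite integral_indic ?setIT//; exact: measurable_below.
rewrite fubini_tonelli//; last 2 first.
- by apply/measurable_EFinP; exact: measurable_indic.
- by move=> p; rewrite lee_fin.
rewrite [RHS]integral_mkcond; apply: eq_integral => y _; rewrite patchE.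
case: ifPn => [|/negP]; rewrite inE/= in_itv/= andbT => y0.
- pose S := [set x | D x /\ y%:E < h x].
  have mS : measurable S by exact: emeasurable_fun_o_infty.
  rewrite -/S -[in RHS](setIT S) -integral_indic//.
  apply: eq_integral => x _; rewrite /ind !indicE; congr ((nat_of_bool _)%:R%:E).
  apply/idP/idP; rewrite !inE /A /S /= /k patchE.
    case: ifPn => [|_ []]; first by rewrite inE => Dx [].
    by rewrite lte_fin ltNge => ->.
  by move=> [Dx lx]; rewrite mem_set.
- apply: integral0_eq => x _; rewrite /ind indicE memNset// /A /= => -[].
  by [].
Qed.

End Preliminaries.

(** * Geometric scales *)

Section GeometricScales.
Variable R : realType.

Lemma geometric_sum_le (q : R) n : (0 < q < 1)%R ->
  (\sum_(0 <= k < n) q ^+ k <= (1 - q)^-1)%R.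
Proof.
move=> /andP[q0 q1]; have q1' : (0 < 1 - q)%R by rewrite subr_gt0.
rewrite -(ler_pM2l q1') mulfV ?gt_eqF//.
rewrite big_mkord -(opprB q 1%R) mulNr -subrX1 opprB.
by rewrite lerBlDr lerDl exprn_ge0// ltW.
Qed.

Lemma exists_geometric_piece (b c x : R) : (1 < b)%R -> (0 < x < c)%R ->
  exists k, (c * b ^- k.+1 <= x < c * b ^- k)%R.
Proof.
move=> b1 /andP[x0 xc]; have c0 : (0 < c)%R := lt_trans x0 xc.
have b0 : (0 < b)%R by rewrite (lt_trans _ b1).
have ex : exists k, (c * b ^- k <= x)%R.
  have bV : `|b^-1| < 1 by rewrite gtr0_norm ?invr_gt0// invf_lt1.
  have xc0 : 0 < x / c by rewrite divr_gt0.
  have [k _ /(_ k (leqnn k))] := (cvgr0Pnorm_le _).1 (cvg_expr bV) _ xc0.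
  rewrite normrX gtr0_norm ?invr_gt0// exprVn ler_pdivlMr// mulrC => kx.
  by exists k.
case: (ex_minnP ex) => -[|k] kx kmin.
  by move: kx; rewrite expr0 invr1 mulr1 leNgt xc.
exists k; rewrite kx/= ltNge; apply/negP => /kmin.
by rewrite ltnn.
Qed.

Lemma geometric_piece_trivIset (b c : R) : (1 < b)%R -> (0 < c)%R ->
  trivIset setT (fun k => `[c * b ^- k.+1, c * b ^- k[%classic).
Proof.
move=> b1 c0; apply/trivIsetP.
suff H i j : (i < j)%N ->
    `[c * b ^- i.+1, c * b ^- i[%classic `&`
    `[c * b ^- j.+1, c * b ^- j[%classic = set0.
  move=> i j _ _; rewrite neq_ltn => /orP[|] ij; first exact: H.
  by rewrite setIC; exact: H.
move=> ij; apply/seteqP; split => x //= -[]; rewrite !in_itv/=.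
move=> /andP[xi _] /andP[_]; apply/negP; rewrite -leNgt; apply: le_trans xi.
have b0 : 0 < b := lt_trans ltr01 b1.
by rewrite ler_pM2l// lef_pV2 ?posrE ?exprn_gt0// ler_eXn2l.
Qed.

Lemma geometric_piece_bigcup (b c : R) : (1 < b)%R -> (0 < c)%R ->
  \bigcup_k `[(c * b ^- k.+1)%R, (c * b ^- k)%R[%classic = `]0%R, c[%classic.
Proof.
move=> b1 c0; have b0 : (0 < b)%R by lra.
apply/seteqP; split => x /=.
  move=> [k _ /=]; rewrite !in_itv/= => /andP[kx xk].
  rewrite (lt_le_trans _ kx)/= ?mulr_gt0 ?invr_gt0 ?exprn_gt0//.
  rewrite (lt_le_trans xk)// ler_piMr ?(ltW c0)// invf_le1 ?exprn_gt0//.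
  by rewrite exprn_ege1// ltW.
rewrite in_itv/= => /(exists_geometric_piece b1)[k kx].
by exists k => //=; rewrite in_itv.
Qed.

Lemma sub_trivIset_pointwise (P Q : nat -> set R) : (forall k, P k `<=` Q k) ->
  trivIset setT Q -> trivIset setT P.
Proof.
by move=> PQ tQ i j _ _ [x [Pi Pj]]; apply: tQ => //; exists x; split; exact: PQ.
Qed.

Local Open Scope ereal_scope.

(** The weights w_k = (1 - q^r) q^(r k) have sum at most 1, so a sum of a_k is
    at most the supremum of a_k / w_k, and the power 1/r of this supremum is
    at most the sum of the powers. This avoids Hoelder's inequality, and the
    loss q^-k is later absorbed by the decay of the dilations. *)
Lemma poweR_sum_le (q r : R) (a : nat -> \bar R) n : (0 < q < 1)%R -> (0 < r)%R ->
  (forall k, 0 <= a k) ->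
  (\sum_(0 <= k < n) a k) `^ r^-1 <=
  \sum_(k <oo) ((1 - q `^ r) `^ (- r^-1) * q ^- k)%R%:E * a k `^ r^-1.
Proof.
move=> /andP[q0 q1] r0 a0; have p0 : (0 < r^-1)%R by rewrite invr_gt0.
pose q' := (q `^ r)%R.
have q'01 : (0 < q' < 1)%R.
  rewrite powR_gt0//=; have := gt0_ltr_powR r0 _ _ q1.
  by rewrite powR1; apply; rewrite nnegrE// ltW.
have q'0 : (0 < q')%R by case/andP: q'01.
pose th := (1 - q')%R.
have th0 : (0 < th)%R by rewrite subr_gt0; case/andP: q'01.
pose w k := (th * q' ^+ k)%R.
have w0 k : (0 < w k)%R by rewrite mulr_gt0// exprn_gt0.
(* The coefficient in the statement is w k to the power - 1/r. *)
have wV k : ((1 - q `^ r) `^ (- r^-1) * q ^- k)%R%:E * a k `^ r^-1 =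
    ((w k)^-1%:E * a k) `^ r^-1.
  rewrite poweRM// ?lee_fin ?invr_ge0 ?(ltW (w0 k))//; congr (_ * _).
  rewrite poweR_EFin; congr (_%:E).
  have wk0 := ltW (w0 k).
  rewrite -[X in _ = (X `^ _)%R]powR_inv1// -powRrM mulN1r.
  rewrite powRM ?exprn_ge0 ?(ltW th0) ?(ltW q'0)//.
  congr (_ * _)%R.
  rewrite -[X in _ = (X `^ _)%R]powR_mulrn ?powR_ge0// -!powRrM.
  have -> : (r * (k%:R * - r^-1) = - k%:R)%R by field; lra.
  by rewrite powR_invn// ltW.
have term0 k : 0 <= ((w k)^-1%:E * a k) `^ r^-1 by exact: poweR_ge0.
rewrite (eq_eseriesr (g := fun k => ((w k)^-1%:E * a k) `^ r^-1)); last first.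
  by move=> k _; exact: wV.
set Y := \sum_(k <oo) _.
have Y0 : 0 <= Y by apply: nneseries_ge0 => k _ _.
have ak k : a k <= (w k)%:E * Y `^ r.
  rewrite -lee_pdivrMl// -[leLHS](@poweRrK _ r^-1%R) ?invrK ?gt_eqF//; last first.
    by rewrite mule_ge0// lee_fin invr_ge0 ltW.
  apply: ler_poweR => //; first exact: ltW.
  rewrite /Y (@nneseriesD1 _ _ k)//.
  by rewrite leeDl//; apply: nneseries_ge0 => i _ _.
have sa : \sum_(0 <= k < n) a k <= Y `^ r.
  apply: (@le_trans _ _ (\sum_(0 <= k < n) (w k)%:E * Y `^ r)); first exact: lee_sum.
  rewrite -ge0_sume_distrl; last by move=> k _; rewrite lee_fin ltW.
  rewrite -[leRHS]mul1e lee_wpmul2r ?poweR_ge0// sumEFin lee_fin.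
  rewrite -mulr_sumr -ler_pdivlMl// mulr1; exact: geometric_sum_le.
have s0 : 0 <= \sum_(0 <= k < n) a k by exact: sume_ge0.
have := ler_poweR (ltW p0) s0 sa.
by rewrite poweRrK// gt_eqF.
Qed.

End GeometricScales.

(** * The decreasing rearrangement *)

Section Rearrangement.
Variable R : realType.
Implicit Types f : R -> \bar R.
Local Notation mu := (@lebesgue_measure R).
Local Notation I := (I01 R).

Lemma measurable_I01 : measurable I.
Proof. exact: measurable_itv. Qed.
Hint Resolve measurable_I01 : core.

Lemma I01_gt0 (x : R) : I x -> (0 < x)%R.
Proof. by rewrite /I01/= in_itv/= => /andP[]. Qed.

Lemma scale_I01 (a x : R) : 0 < a <= 1 -> I x -> I (x * a).
Proof.
move=> /andP[a0 a1]; rewrite /I01/= !in_itv/= => /andP[x0 x1].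
by rewrite mulr_gt0//= (le_lt_trans _ x1)// ler_piMr// ltW.
Qed.

Local Open Scope ereal_scope.

Lemma mu_I01 : mu I = 1.
Proof.
by rewrite /I01 lebesgue_measure_itv/= lte_fin ltr01 oppr0 adde0.
Qed.

Lemma measurable_superlevel f (lam : R) : measurable_fun I f ->
  measurable [set x | I x /\ lam%:E < `|f x|].
Proof.
move=> mf; apply: emeasurable_fun_o_infty => //.
exact: measurableT_comp.
Qed.

Lemma rearr_ge0 f s : 0 <= rearr f s.
Proof. by apply: le_ereal_inf_tmp => _ [t [t0 _] <-]; rewrite lee_fin ltW. Qed.

Lemma rearr_nonincreasing f (s t : R) : (s <= t)%R -> rearr f t <= rearr f s.
Proof.
move=> st; apply: ereal_inf_le_tmp => _ [u [u0 us] <-].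
by exists u => //; split => //; rewrite (le_trans us)// lee_fin.
Qed.

(** The Galois connection between the rearrangement and the distribution
    function, from which powers and the integral of the rearrangement are
    computed. *)
Lemma lt_rearr f (lam s : R) : measurable_fun I f -> (0 <= lam)%R ->
  (lam%:E < rearr f s) = (s%:E < mu [set x | I x /\ lam%:E < `|f x|]).
Proof.
move=> mf lam0; apply/idP/idP; apply: contraTT; rewrite -!leNgt => h.
- apply/lee_addgt0Pr => e e0; rewrite -EFinD.
  apply: ereal_inf_lbound; exists (lam + e)%R => //; split; first lra.
  apply: le_trans h; apply: le_measure; rewrite ?inE;
    [exact: measurable_superlevel|exact: measurable_superlevel|].
  move=> x [Ix lx]; split => //; apply: le_lt_trans lx.
  by rewrite lee_fin; lra.
- (* The distribution function is right-continuous: the superlevel set at lam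
     is the increasing union of those at lam + 1/(n+1). *)
  pose F n := [set x | I x /\ (lam + n.+1%:R^-1)%:E < `|f x|].
  have UF : \bigcup_n F n = [set x | I x /\ lam%:E < `|f x|].
    apply/seteqP; split => x /=.
      move=> [n _ [Ix lx]]; split => //; apply: le_lt_trans lx.
      by rewrite lee_fin lerDl.
    move=> [Ix]; case E : `|f x| => [v| |] lv //.
      have [n hn] : exists n, (lam + n.+1%:R^-1 < v)%R.
        exists (Num.truncn (v - lam)^-1).
        have vl : (0 < v - lam)%R by rewrite subr_gt0 -lte_fin.
        rewrite -ltrBrDl -[ltRHS]invrK ltf_pV2 ?posrE ?invr_gt0//.
        exact: truncnS_gt.
      by exists n => //; split => //; rewrite E lte_fin.
    by exists 0%N => //; split => //; rewrite E ltry.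
  have mF n : measurable (F n) by exact: measurable_superlevel.
  have := @nondecreasing_cvg_mu _ _ _ mu F mF.
  rewrite UF => /(_ (measurable_superlevel _ mf)) cF.
  have {}cF : mu \o F @ \oo --> mu [set x | I x /\ lam%:E < `|f x|].
    apply: cF; move=> m n mn; apply/subsetPset => x [Ix lx]; split => //.
    apply: le_lt_trans lx; rewrite lee_fin lerD2l lef_pV2 ?posrE//.
    by rewrite ler_nat.
  rewrite -(cvg_lim _ cF)//; apply: lime_le.
    by apply/cvg_ex; eexists; exact: cF.
  near=> n; rewrite /= leNgt; apply/negP => sF.
  have : (lam + n.+1%:R^-1)%:E <= rearr f s.
    apply: le_ereal_inf_tmp => _ [t [t0 ts] <-].
    rewrite leNgt; apply/negP => tl.
    have : mu (F n) <= s%:E.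
      apply: le_trans ts; apply: le_measure; rewrite ?inE;
        [exact: measurable_superlevel|exact: measurable_superlevel|].
      by move=> x [Ix lx]; split => //; exact: lt_trans lx.
    by rewrite leNgt sF.
  move=> /le_trans /(_ h); rewrite lee_fin leNgt => /negP; apply.
  by rewrite ltrDl.
Unshelve. all: by end_near. Qed.

(** As f is finite almost everywhere, the measures of the sets where |f| > n
    decrease to 0. *)
Lemma rearr_fin_num f (s : R) : L0 f -> (0 < s)%R -> rearr f s \is a fin_num.
Proof.
move=> [mf ff] s0; rewrite ge0_fin_numE ?rearr_ge0//.
pose F n := [set x | I x /\ n%:R%:E < `|f x|].
have mF n : measurable (F n) by exact: measurable_superlevel.
have cF : mu \o F @ \oo --> mu (\bigcap_n F n).
  apply: nonincreasing_cvg_mu => //.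
  - rewrite (@le_lt_trans _ _ (mu I))//; last by rewrite mu_I01 ltry.
    apply: le_measure; rewrite ?inE; [exact: mF|exact: measurable_I01|].
    by move=> x [].
  - exact: bigcapT_measurable.
  - move=> m n mn; apply/subsetPset => x [Ix lx]; split => //.
    by apply: le_lt_trans lx; rewrite lee_fin ler_nat.
have F0 : mu (\bigcap_n F n) = 0.
  apply: measure_negligible; first exact: bigcapT_measurable.
  apply: negligibleS ff => x /= Fx /(_ (Fx 0%N Logic.I).1).
  apply/negP; rewrite fin_num_abs -leNgt leye_eq; apply/eqP/eqyP => A A0.
  have [_ /ltW] := Fx (Num.truncn A).+1 Logic.I; apply: le_trans.
  by rewrite lee_fin ltW// truncnS_gt.
have [n Fn] : exists n, mu (F n) < s%:E.
  apply: contrapT => /forallNP Fs.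
  have : s%:E <= 0.
    rewrite -F0 -(cvg_lim _ cF)//; apply: lime_ge.
      by apply/cvg_ex; eexists; exact: cF.
    by apply: nearW => n; rewrite leNgt; apply/negP; exact: Fs.
  by rewrite lee_fin leNgt s0.
apply: le_lt_trans (ltry n.+1%:R).
apply: ereal_inf_lbound; exists n.+1%:R => //; split => //.
apply: le_trans (ltW Fn); apply: le_measure; rewrite ?inE;
  [exact: measurable_superlevel|exact: mF|].
move=> x [Ix lx]; split => //; apply: le_lt_trans lx.
by rewrite lee_fin ler_nat.
Qed.

Lemma measurable_abspow (r : R) f : measurable_fun I f ->
  measurable_fun I (abspow r f).
Proof.
move=> mf; apply: (@measurableT_comp _ _ _ _ _ _ (fun x => x `^ r)).
  exact: measurable_poweR.
exact: measurableT_comp.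
Qed.

Lemma abspow_ge0 (r : R) f x : 0 <= abspow r f x.
Proof. exact: poweR_ge0. Qed.

Lemma rearr_abspow (r : R) f s : (0 < r)%R -> measurable_fun I f ->
  rearr (abspow r f) s = rearr f s `^ r.
Proof.
move=> r0 mf; apply: eq_ge0_lt => [||lam lam0].
- exact: rearr_ge0.
- exact: poweR_ge0.
rewrite lt_rearr//; last exact: measurable_abspow.
rewrite lt_poweR ?rearr_ge0// lt_rearr ?powR_ge0//.
have E x : (lam%:E < `|abspow r f x|) = ((lam `^ r^-1)%R%:E < `|f x|).
  by rewrite gee0_abs ?abspow_ge0// lt_poweR.
by under eq_set do rewrite E.
Qed.

Lemma L0_abspow (r : R) f : L0 f -> L0 (abspow r f).
Proof.
move=> [mf ff]; split; first exact: measurable_abspow.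
move: ff; apply: filterS; first exact: (ae_filter_ringOfSetsType mu).
by move=> x ff Ix; apply: fin_num_poweR; rewrite abse_fin_num; exact: ff.
Qed.

Lemma measurable_rearr f (i : interval R) : measurable_fun [set` i] (rearr f).
Proof.
apply: emeasurable_nonincreasing; first exact: interval_is_interval.
by move=> s t _ _; exact: rearr_nonincreasing.
Qed.

(** The set where Rf > lam is the interval (0, d(lam)), with d the
    distribution function of f, so both sides have the same layer cake
    integral. *)
Lemma integral_rearr f : measurable_fun I f ->
  \int[mu]_(x in I) `|f x| = \int[mu]_(x in `]0%R, 1%R[) rearr f x.
Proof.
move=> mf; rewrite [LHS]layer_cake//; last exact: measurableT_comp.
rewrite [RHS]layer_cake//; last 2 first.
- exact: measurable_rearr.
- by move=> x _; exact: rearr_ge0.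
apply: eq_integral => lam; rewrite inE/= in_itv/= andbT => lam0.
  set d := mu [set x | I x /\ _].
  have -> : [set x | `]0%R, 1%R[%classic x /\ lam%:E < rearr f x] =
      [set x | I x /\ x%:E < d].
    by apply/seteqP; split => x /= [Ix] dx; rewrite lt_rearr// in dx *.
  have d0 : 0 <= d by exact: measure_ge0.
  have d1 : d <= 1.
    rewrite -mu_I01; apply: le_measure; rewrite ?inE; last by move=> x [].
      exact: measurable_superlevel.
    exact: measurable_I01.
  move: d d0 d1 => [v| |]//; rewrite !lee_fin => v0 v1.
  have -> : [set x | I x /\ x%:E < v%:E] = `]0%R, v[%classic.
    apply/seteqP; split => x /=; rewrite /I01/= !in_itv/= lte_fin.
      by move=> [/andP[-> _]].
    by move=> /andP[x0 xv]; rewrite x0 xv/= (lt_le_trans xv).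
  rewrite lebesgue_measure_itv/= lte_fin oppr0 adde0.
  by move: v0; rewrite le_eqVlt => /predU1P[<-|->//]; rewrite ltxx.
Qed.

End Rearrangement.

(** * The maximal function of the rearrangement *)

Section Maximal.
Variable R : realType.
Implicit Types f g F : R -> \bar R.
Local Notation mu := (@lebesgue_measure R).
Local Notation I := (I01 R).
Local Open Scope ereal_scope.
Hint Resolve measurable_I01 : core.

Lemma rearr_integral_split f (s t : R) : (0 < s)%R -> (s < t)%R ->
  \int[mu]_(x in `]0%R, t[) rearr f x =
  \int[mu]_(x in `]0%R, s[) rearr f x + \int[mu]_(x in `[s, t[) rearr f x.
Proof.
move=> s0 st.
have E : `]0%R, t[%classic = `]0%R, s[%classic `|` `[s, t[%classic.
  by apply: itv_bndbnd_setU; rewrite bnd_simp// ltW.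
rewrite E ge0_integral_setU//.
- by rewrite -E; exact: measurable_rearr.
- by move=> x _; exact: rearr_ge0.
- apply/disj_setPS => x [] /=; rewrite !in_itv/= => /andP[_ xs] /andP[sx _].
  by move: sx; rewrite leNgt xs.
Qed.

Lemma rearr_integral_le f (s t : R) : (0 < s)%R -> (s < t)%R ->
  \int[mu]_(x in `[s, t[) rearr f x <= (t - s)%:E * rearr f s.
Proof.
move=> s0 st.
rewrite -(mu_itvco (ltW st)) muleC -integral_cst//.
apply: ge0_le_integral => //.
- by move=> x _; exact: rearr_ge0.
- exact: measurable_rearr.
- by move=> x /=; rewrite in_itv/= => /andP[sx _]; exact: rearr_nonincreasing.
Qed.

Lemma rearr_integral_ge f (s t : R) : (0 < s)%R -> (s < t)%R ->
  (t - s)%:E * rearr f t <= \int[mu]_(x in `[s, t[) rearr f x.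
Proof.
move=> s0 st.
rewrite -(mu_itvco (ltW st)) muleC -integral_cst//.
apply: ge0_le_integral => //.
- by move=> x _; exact: rearr_ge0.
- exact: measurable_rearr.
- by move=> x /=; rewrite in_itv/= => /andP[_ xt]; exact/rearr_nonincreasing/ltW.
Qed.

Lemma integral_rearr_ge0 f (A : set R) : 0 <= \int[mu]_(x in A) rearr f x.
Proof. by apply: integral_ge0 => x _; exact: rearr_ge0. Qed.
Hint Resolve integral_rearr_ge0 rearr_ge0 : core.

Lemma integral_rearr_le f (s t : R) : (s <= t)%R ->
  \int[mu]_(x in `]0%R, s[) rearr f x <= \int[mu]_(x in `]0%R, t[) rearr f x.
Proof.
move=> st; apply: ge0_subset_integral => //; first exact: measurable_rearr.
move=> x /=; rewrite !in_itv/= => /andP[-> xs]/=; exact: lt_le_trans st.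
Qed.

Lemma maxrearr_ge0 f (t : R) : (0 <= t)%R -> 0 <= maxrearr f t.
Proof. by move=> t0; apply: mule_ge0 => //; rewrite lee_fin invr_ge0. Qed.

Lemma measurable_maxrearr f : measurable_fun I (maxrearr f).
Proof.
apply: emeasurable_funM.
  apply: emeasurable_nonincreasing; first exact: interval_is_interval.
  move=> s t; rewrite /I01/= !in_itv/= => /andP[s0 _] /andP[t0 _] st.
  by rewrite lee_fin lef_pV2.
apply: emeasurable_nondecreasing; first exact: interval_is_interval.
by move=> s t _ _; exact: integral_rearr_le.
Qed.

Lemma mul_rearr_le_integral f (t : R) : (0 < t)%R ->
  t%:E * rearr f t <= \int[mu]_(x in `]0%R, t[) rearr f x.
Proof.
move=> t0.
have mt : mu `]0%R, t[%classic = t%:E.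
  by rewrite lebesgue_measure_itv/= lte_fin t0 oppr0 adde0.
rewrite -mt muleC -integral_cst//.
apply: ge0_le_integral => //.
- by move=> x _; exact: rearr_ge0.
- exact: measurable_rearr.
by move=> x /=; rewrite in_itv/= => /andP[_ xt]; exact/rearr_nonincreasing/ltW.
Qed.

Lemma rearr_le_maxrearr f (t : R) : (0 < t)%R -> rearr f t <= maxrearr f t.
Proof.
move=> t0; rewrite /maxrearr lee_pdivlMl//.
exact: mul_rearr_le_integral.
Qed.

(** The means of a nonincreasing function over (0, t) decrease in t. The proof
    only adds and multiplies, because the integrals may be infinite. *)
Lemma integral_rearr_le_maxrearr f (t : R) : (0 < t < 1)%R ->
  \int[mu]_(x in `]0%R, 1%R[) rearr f x <= maxrearr f t.
Proof.
move=> /andP[t0 t1]; rewrite (rearr_integral_split f t0 t1).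
(* The part over [t, 1) is at most (1 - t) Rf(t), hence (1 - t) Mf(t). *)
have h1 := rearr_integral_le f t0 t1.
apply: le_trans (leeD2l _ h1) _.
have h2 : (1 - t)%:E * rearr f t <=
    (1 - t)%:E * (t^-1%:E * \int[mu]_(x in `]0%R, t[) rearr f x).
  rewrite lee_pmul2l//; first exact: rearr_le_maxrearr.
  by rewrite lte_fin subr_gt0.
apply: le_trans (leeD2l _ h2) _.
rewrite muleA -[X in X + _]mul1e -ge0_muleDl//; last first.
  by rewrite lee_fin mulr_ge0 ?invr_ge0// ?subr_ge0 ltW.
rewrite /maxrearr -EFinM -EFinD lee_wpmul2r// lee_fin.
by rewrite mulrBl mul1r mulfV ?gt_eqF// addrCA subrr addr0.
Qed.

Lemma maxrearr_le_integral_rearr f (b t : R) : (0 < b)%R -> (b^-1 <= t <= 1)%R ->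
  maxrearr f t <= b%:E * \int[mu]_(x in `]0%R, 1%R[) rearr f x.
Proof.
move=> b0 /andP[bt t1]; apply: lee_pmul => //.
- by rewrite lee_fin invr_ge0 (le_trans _ bt)// invr_ge0 ltW.
- rewrite lee_fin -[leRHS]invrK lef_pV2// posrE ?invr_gt0//.
  by rewrite (lt_le_trans _ bt)// invr_gt0.
- exact: integral_rearr_le.
Qed.

Lemma integral_rearr_fin f (t : R) : (t <= 1)%R ->
  \int[mu]_(x in `]0%R, 1%R[) rearr f x < +oo ->
  \int[mu]_(x in `]0%R, t[) rearr f x \is a fin_num.
Proof.
move=> t1 h; rewrite ge0_fin_numE//; apply: le_lt_trans h.
exact: integral_rearr_le.
Qed.

(** Discrete counterpart of t (Mf)'(t) = - (Mf(t) - Rf(t)): multiplied by t,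
    it says that the integral of Rf over [t, b t) is at least (b - 1) t times
    the value of Rf at b t. *)
Lemma maxrearr_step f (b t : R) : L0 f -> (1 < b)%R -> (0 < t)%R -> (b * t < 1)%R ->
  \int[mu]_(x in `]0%R, 1%R[) rearr f x < +oo ->
  maxrearr f t <=
  maxrearr f (b * t) + (b - 1)%:E * (maxrearr f (b * t) - rearr f (b * t)).
Proof.
move=> Lf b1 t0 bt1 fi.
have tbt : (t < b * t)%R by rewrite ltr_pMl.
have bt0 : (0 < b * t)%R := lt_trans t0 tbt.
have := rearr_integral_split f t0 tbt.
have := rearr_integral_ge f t0 tbt.
have := fineK (integral_rearr_fin (ltW bt1) fi).
have := fineK (integral_rearr_fin (ltW (lt_trans tbt bt1)) fi).
have := fineK (rearr_fin_num Lf bt0).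
rewrite /maxrearr.
set u := fine (rearr _ _) => <-.
set v := fine _ => <-; set w := fine _ => <- h1 h2.
have {h1 h2} h : (v + (b * t - t) * u <= w)%R.
  by rewrite -lee_fin EFinD EFinM h2 leeD2l.
rewrite -!EFinM -EFinD lee_fin.
have -> : ((b * t)^-1 * w + (b - 1) * ((b * t)^-1 * w - u) =
    t^-1 * (w - (b * t - t) * u))%R.
  by field; apply/andP; split; lra.
rewrite ler_pM2l ?invr_gt0//; lra.
Qed.

(** On [t b^-(k+1), t b^-k) the function Rf is at most its value at the left
    end. *)
Lemma maxrearr_le_series f (b t : R) : (1 < b)%R -> (0 < t)%R ->
  maxrearr f t <=
  \sum_(k <oo) ((b - 1) * b ^- k.+1)%:E * rearr f (t * b ^- k.+1).
Proof.
move=> b1 t0; have b0 : (0 < b)%R by lra.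
rewrite /maxrearr -(geometric_piece_bigcup b1 t0) ge0_integral_bigcup//=; last 2 first.
- by rewrite (geometric_piece_bigcup b1 t0); exact: measurable_rearr.
- exact: geometric_piece_trivIset.
rewrite -nneseriesZl//.
apply: lee_nneseries => [k _ _|k _].
  by apply: mule_ge0 => //; rewrite lee_fin invr_ge0 ltW.
have h : (t * b ^- k.+1 < t * b ^- k)%R.
  by rewrite ltr_pM2l// ltf_pV2 ?posrE ?exprn_gt0// ltr_eXn2l.
have h0 : (0 < t * b ^- k.+1)%R by rewrite mulr_gt0// invr_gt0 exprn_gt0.
have := rearr_integral_le f h0 h.
rewrite -(@lee_pmul2l _ t^-1%:E)// ?lte_fin ?invr_gt0//.
move/le_trans; apply; rewrite muleA -EFinM.
apply: lee_wpmul2r; first exact: rearr_ge0.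
have bk : (b ^+ k != 0)%R by rewrite gt_eqF// exprn_gt0.
rewrite lee_fin exprS le_eqVlt; apply/orP; left; apply/eqP; field.
by rewrite bk/=; apply/andP; split; lra.
Qed.

End Maximal.

Section MaximalComparison.
Variable R : realType.
Implicit Types f g F : R -> \bar R.
Local Notation mu := (@lebesgue_measure R).
Local Notation I := (I01 R).
Local Open Scope ereal_scope.

(** The easy comparison of the two maximal functions, by Jensen's inequality
    up to a constant. *)
Lemma maxrearr_abspow_le (r : R) f (t : R) : (0 < r <= 1)%R ->
  measurable_fun I f -> (0 < t)%R ->
  maxrearr (abspow r f) t `^ r^-1 <= (2 `^ r^-1)%R%:E * maxrearr f t.
Proof.
move=> /[dup] r01 /andP[r0 r1] mf t0.
have rV : (0 < r^-1)%R by rewrite invr_gt0.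
have := maxrearr_ge0 f (ltW t0).
case E : (maxrearr f t) => [A| |]// A0; last first.
  by rewrite gt0_muley ?lte_fin ?powR_gt0// leey.
rewrite lee_fin in A0.
apply/lee_addgt0Pr => e e0.
(* The mean A may vanish, hence a positive c slightly above it; the excess
   contributes e to the final bound. *)
pose c := (A + e / 2 `^ r^-1)%R.
have c0 : (0 < c)%R by rewrite ltr_wpDl// divr_gt0// powR_gt0.
have mt : mu `]0%R, t[%classic = t%:E.
  by rewrite lebesgue_measure_itv/= lte_fin t0 oppr0 adde0.
have h : maxrearr (abspow r f) t <= (2 * c `^ r)%R%:E.
  rewrite /maxrearr lee_pdivrMl//.
  have : \int[mu]_(s in `]0%R, t[) rearr (abspow r f) s <=
      \int[mu]_(s in `]0%R, t[) ((c `^ r)%R%:E * (1 + c^-1%:E * rearr f s)).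
    apply: ge0_le_integral => //.
    - by move=> s _; exact: rearr_ge0.
    - exact: measurable_rearr.
    - apply: emeasurable_funM => //; apply: emeasurable_funD => //.
      by apply: emeasurable_funM => //; exact: measurable_rearr.
    - by move=> s _; rewrite rearr_abspow// poweR_le_affine// rearr_ge0.
  move=> /le_trans; apply.
  rewrite ge0_integralZl_EFin//; last 3 first.
  - by move=> s _; rewrite adde_ge0// mule_ge0// ?rearr_ge0// lee_fin invr_ge0 ltW.
  - apply: emeasurable_funD => //.
    by apply: emeasurable_funM => //; exact: measurable_rearr.
  - exact: powR_ge0.
  rewrite ge0_integralD//; last 2 first.
  - by move=> s _; rewrite mule_ge0// ?rearr_ge0// lee_fin invr_ge0 ltW.
  - by apply: emeasurable_funM => //; exact: measurable_rearr.
  rewrite ge0_integralZl_EFin//; last 3 first.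
  - by move=> s _; exact: rearr_ge0.
  - exact: measurable_rearr.
  - by rewrite invr_ge0 ltW.
  rewrite integral_cst// mul1e [X in _ * (X + _)]mt.
  have -> : \int[mu]_(s in `]0%R, t[) rearr f s = (t * A)%:E.
    by rewrite EFinM -E /maxrearr muleA -EFinM mulfV ?gt_eqF// mul1e.
  rewrite -!EFinM lee_fin.
  have ->: (t * (2 * c `^ r) = c `^ r * (t + t))%R by ring.
  rewrite ler_wpM2l ?powR_ge0// lerD2l mulrCA ler_piMr ?(ltW t0)//.
  by rewrite ler_pdivrMl// mulr1 lerDl divr_ge0 ?powR_ge0// ltW.
have h2 := ler_poweR (ltW rV) (maxrearr_ge0 _ (ltW t0)) h.
apply: le_trans h2 _; rewrite poweR_EFin lee_fin powRM ?powR_ge0//.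
rewrite -powRrM mulfV ?gt_eqF// powRr1 ?(ltW c0)//.
by rewrite mulrDr lerD2l mulrCA mulfV ?mulr1// gt_eqF// powR_gt0.
Qed.

Lemma osc_ge0 g (t : R) : L0 g -> (0 < t)%R -> 0 <= maxrearr g t - rearr g t.
Proof.
by move=> Lg t0; rewrite sube_ge0 ?rearr_fin_num// rearr_le_maxrearr.
Qed.

(** With these bounds on a and s the cut-off at 1 in the definition of a
    dilation is inactive on both sides. *)
Lemma dilation_scale (s a t : R) F : (1 <= a)%R -> (0 < s <= 1)%R ->
  dilation s F (a * t) = dilation (s * a^-1) F t.
Proof.
move=> a1 /andP[s0 s1]; have a0 : (0 < a)%R := lt_le_trans ltr01 a1.
have sa1 : (s / a <= 1)%R by rewrite ler_pdivrMr// mul1r (le_trans s1).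
rewrite /dilation !min_r// pmulr_rgt0// (mulrC a t) ltr_pdivlMr//.
case: ifP => // _; congr (F _); rewrite invfM invrK; ring.
Qed.

(** Iterates the step from t to b t until the argument lies in [1/b, 1), where
    the maximal function is at most b times the full integral. The term with
    the oscillation at t is kept on the left, so that the induction uses the
    oscillation at each scale once. *)
Lemma maxrearr_le_dilation_sum (b : R) g n (t : R) : L0 g -> (1 < b)%R ->
  \int[mu]_(x in `]0%R, 1%R[) rearr g x < +oo ->
  I t -> (1 <= b ^+ n.+1 * t)%R ->
  maxrearr g t + (b - 1)%:E * (maxrearr g t - rearr g t) <=
  \sum_(0 <= k < n.+1) dilation (b ^- k)
     (fun x => (b - 1)%:E * (maxrearr g x - rearr g x) +
       b%:E * \int[mu]_(x in `]0%R, 1%R[) rearr g x) t.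
Proof.
move=> Lg b1 gi; have b0 : (0 < b)%R by lra.
set J := \int[mu]_(x in _) _.
set O := fun x => maxrearr g x - rearr g x.
pose u x := (b - 1)%:E * O x + b%:E * J.
have J0 : 0 <= J by exact: integral_rearr_ge0.
have u0 x : (0 < x)%R -> 0 <= u x.
  move=> x0; rewrite adde_ge0// mule_ge0 ?osc_ge0// lee_fin; lra.
have BV k : (0 < b ^- k)%R by rewrite invr_gt0 exprn_gt0.
have du0 k x : 0 <= dilation (b ^- k) u x.
  by rewrite /dilation; case: ifPn => // /andP[x0 _]; apply: u0; rewrite divr_gt0.
have d0 x : I x -> dilation (b ^- 0) u x = u x.
  by rewrite /I01/= in_itv/= => Ix; rewrite /dilation expr0 invr1 minxx Ix divr1.
have base x : I x -> (1 <= b * x)%R -> maxrearr g x + (b - 1)%:E * O x <= u x.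
  move=> Ix bx; rewrite /u addeC leeD2l//.
  apply: maxrearr_le_integral_rearr => //.
  move: Ix; rewrite /I01/= in_itv/= => /andP[_ /ltW ->]; rewrite andbT.
  by rewrite -[leLHS]mul1r ler_pdivrMr// mulrC.
rewrite -/u.
elim: n t => [|n ih] t It.
  by rewrite expr1 => bt; rewrite big_nat1 d0// base.
move=> bt; rewrite big_nat_recl//= d0//.
have [bt1|bt1] := leP 1%R (b * t)%R.
  apply: le_trans (base _ It bt1) _; rewrite leeDl//.
  by apply: sume_ge0.
have t0 : (0 < t)%R by move: It; rewrite /I01/= in_itv/= => /andP[].
have Ibt : I (b * t)%R by rewrite /I01/= in_itv/= mulr_gt0.
have := ih _ Ibt; rewrite mulrA -exprSr => /(_ bt).
have -> : \sum_(0 <= k < n.+1) dilation (b ^- k) u (b * t)%R =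
    \sum_(0 <= k < n.+1) dilation (b ^- k.+1) u t.
  apply: eq_bigr => k _; rewrite dilation_scale ?(ltW b1)//; last first.
    by rewrite BV invf_le1 ?exprn_gt0// exprn_ege1// ltW.
  by rewrite exprSr invfM.
move=> h; rewrite [leRHS]addeC; apply: le_trans (leeD2r _ h).
rewrite -/(O _).
have st := maxrearr_step Lg b1 t0 bt1 gi.
apply: leeD => //.
by rewrite /u leeDl// mule_ge0// lee_fin ltW.
Qed.

End MaximalComparison.

(** * Function norms and dilations *)

Section FunctionNorm.
Variable R : realType.
Variable rho : (R -> \bar R) -> \bar R.
Hypothesis hrho : banach_function_norm rho.
Implicit Types F G : R -> \bar R.
Local Notation mu := (@lebesgue_measure R).
Local Notation I := (I01 R).
Local Open Scope ereal_scope.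
Hint Resolve measurable_I01 : core.

Lemma aeI (P : R -> Prop) : (forall x, I x -> P x) -> {ae mu, forall x, I x -> P x}.
Proof. by move=> h; apply: aeW => x; exact: h. Qed.

Lemma Mplus_eq F G : Mplus F -> (forall x, I x -> F x = G x) -> Mplus G.
Proof.
move=> [mF F0] FG; split; last by move=> x Ix; rewrite -FG// F0.
by apply: eq_measurable_fun mF => x; rewrite inE; exact: FG.
Qed.

Lemma MplusZ (a : R) F : (0 <= a)%R -> Mplus F -> Mplus (fun x => a%:E * F x).
Proof.
move=> a0 [mF F0]; split; last by move=> x Ix; rewrite mule_ge0// F0.
exact: emeasurable_funM.
Qed.

Lemma MplusD F G : Mplus F -> Mplus G -> Mplus (fun x => F x + G x).
Proof.
move=> [mF F0] [mG G0]; split; last by move=> x Ix; rewrite adde_ge0 ?F0 ?G0.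
exact: emeasurable_funD.
Qed.

Lemma MplusM F G : Mplus F -> Mplus G -> Mplus (fun x => F x * G x).
Proof.
move=> [mF F0] [mG G0]; split; last by move=> x Ix; rewrite mule_ge0 ?F0 ?G0.
exact: emeasurable_funM.
Qed.

Lemma Mplus_poweR (p : R) F : Mplus F -> Mplus (fun x => F x `^ p).
Proof.
move=> [mF _]; split; last by move=> x _; exact: poweR_ge0.
exact: (measurableT_comp (measurable_poweR p)).
Qed.

Lemma Mplus_cst (a : \bar R) : 0 <= a -> Mplus (fun _ : R => a).
Proof. by move=> a0; split. Qed.

Lemma Mplus_indic (E : set R) : measurable E -> Mplus (fun x => (\1_E x)%:E).
Proof.
move=> mE; split; last by move=> x _; rewrite lee_fin.
by apply/measurable_EFinP; exact: measurable_indic.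
Qed.

Lemma Mplus_sum (s : nat -> R -> \bar R) n : (forall k, Mplus (s k)) ->
  Mplus (fun x => \sum_(0 <= k < n) s k x).
Proof.
move=> Ms; split; last by move=> x Ix; apply: sume_ge0 => k _; exact: (Ms k).2.
by apply: emeasurable_sum => k; exact: (Ms k).1.
Qed.

Lemma Mplus_series (s : nat -> R -> \bar R) : (forall k, Mplus (s k)) ->
  Mplus (fun x => \sum_(k <oo) s k x).
Proof.
move=> Ms; split; last by move=> x Ix; apply: nneseries_ge0 => k _ _; exact: (Ms k).2.
apply: ge0_emeasurable_sum; last by move=> k _; exact: (Ms k).1.
by move=> k x Ix _; exact: (Ms k).2.
Qed.

Lemma norm_le F G : Mplus F -> Mplus G -> (forall x, I x -> F x <= G x) ->
  rho F <= rho G.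
Proof. by move=> MF MG FG; apply: (bfn_le hrho) => //; exact: aeI. Qed.

Lemma norm_eq F G : Mplus F -> (forall x, I x -> F x = G x) -> rho F = rho G.
Proof.
move=> MF FG; have MG := Mplus_eq MF FG; apply/eqP; rewrite eq_le.
by rewrite !norm_le// => x Ix; rewrite FG.
Qed.

Lemma norm0 : rho (fun=> 0) = 0.
Proof. by apply/(bfn_eq0 hrho); [exact: Mplus_cst|exact: aeI]. Qed.

Lemma norm_sum (s : nat -> R -> \bar R) n : (forall k, Mplus (s k)) ->
  rho (fun x => \sum_(0 <= k < n) s k x) <= \sum_(0 <= k < n) rho (s k).
Proof.
move=> Ms; elim: n => [|n ih].
  rewrite big_nil -[leRHS]norm0 (@norm_eq _ (fun=> 0))//; first exact: Mplus_sum.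
  by move=> x _; rewrite big_nil.
rewrite big_nat_recr//=; apply: le_trans (leeD2r _ ih).
apply: le_trans (bfnD hrho (Mplus_sum n Ms) (Ms n)).
rewrite (@norm_eq _ (fun x => \sum_(0 <= k < n) s k x + s n x))//.
  exact: Mplus_sum.
by move=> x _; rewrite big_nat_recr.
Qed.

(** Countable triangle inequality, from the Fatou property. *)
Lemma norm_series (s : nat -> R -> \bar R) (q : R) (a : \bar R) :
  (0 < q < 1)%R -> 0 <= a -> (forall k, Mplus (s k)) ->
  (forall k, rho (s k) <= (q ^+ k)%:E * a) ->
  rho (fun x => \sum_(k <oo) s k x) <= (1 - q)^-1%:E * a.
Proof.
move=> /andP[q0 q1] a0 Ms sa.
pose F n x := \sum_(0 <= k < n) s k x.
have cF : rho (F n) @[n --> \oo] --> rho (fun x => \sum_(k <oo) s k x).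
  apply: (bfn_fatou hrho); [by move=> n; exact: Mplus_sum|exact: Mplus_series|].
  apply: aeI => x Ix; have s0 k : 0 <= s k x by exact: (Ms k).2.
  split; last by apply: is_cvg_nneseries => k _ _.
  by move=> n; rewrite /F big_nat_recr//= leeDl.
rewrite -(cvg_lim _ cF)//; apply: lime_le.
  by apply/cvg_ex; eexists; exact: cF.
apply: nearW => n; apply: le_trans (norm_sum n Ms) _.
apply: (@le_trans _ _ (\sum_(0 <= k < n) (q ^+ k)%:E * a)).
  by apply: lee_sum => k _; exact: sa.
rewrite -ge0_sume_distrl; last by move=> k _; rewrite lee_fin exprn_ge0// ltW.
rewrite sumEFin lee_wpmul2r// lee_fin.
by apply: geometric_sum_le; rewrite q0.
Qed.

End FunctionNorm.

Section Dilation.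
Variable R : realType.
Variable rho : (R -> \bar R) -> \bar R.
Hypothesis hrho : banach_function_norm rho.
Implicit Types F G : R -> \bar R.
Local Notation mu := (@lebesgue_measure R).
Local Notation I := (I01 R).
Local Open Scope ereal_scope.
Hint Resolve measurable_I01 : core.

Lemma norm_cst1_lty : rho (fun=> 1) < +oo.
Proof.
have := bfn_indic hrho (@measurable_I01 R) (@subset_refl _ I).
rewrite (@norm_eq _ _ hrho _ (fun=> 1))//; first exact: Mplus_indic.
by move=> x Ix; rewrite indicE mem_set.
Qed.

Lemma norm_indic_gt0 (E : set R) : measurable E -> E `<=` I -> 0 < mu E ->
  0 < rho (fun x => (\1_E x)%:E).
Proof.
move=> mE EI E0; rewrite lt_neqAle eq_sym (bfn_ge0 hrho) ?andbT;
  last exact: Mplus_indic.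
apply/eqP => /(bfn_eq0 hrho (Mplus_indic mE)) h.
move: E0; rewrite (_ : mu E = 0) ?ltxx//.
apply: measure_negligible => //.
apply: negligibleS h => x Ex /(_ (EI _ Ex))/eqP.
by rewrite indicE mem_set//= eqe oner_eq0.
Qed.

(** Here y may be infinite, in which case all multiples of the indicator lie
    below F and the norm of F is infinite. *)
Lemma norm_ge_indic (E : set R) (y : \bar R) F : measurable E -> E `<=` I ->
  0 < mu E -> 0 <= y -> Mplus F -> (forall x, E x -> y <= F x) ->
  y * rho (fun x => (\1_E x)%:E) <= rho F.
Proof.
move=> mE EI E0 y0 MF yF; have ME := Mplus_indic mE.
have d0 := norm_indic_gt0 mE EI E0.
have H (z : R) : (0 <= z)%R -> z%:E <= y ->
    z%:E * rho (fun x => (\1_E x)%:E) <= rho F.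
  move=> z0 zy; rewrite -(bfnZ hrho)//; apply: (norm_le hrho) => //.
    exact: MplusZ.
  move=> x Ix; rewrite indicE; case: (boolP (x \in E)) => [|_].
    by rewrite inE mule1 => Ex; rewrite (le_trans zy)// yF.
  by rewrite mule0; exact: MF.2.
case: y y0 yF H => [y| |]// y0 yF H; first exact: H.
have df := bfn_indic hrho mE EI.
rewrite gt0_mulye// leye_eq; apply/eqP/eqyP => A A0.
set d := rho _ in d0 df H *.
have dE : (fine d)%:E = d by rewrite fineK// ge0_fin_numE// ltW.
have fd0 : (0 < fine d)%R by rewrite -lte_fin dE.
apply: le_trans (H (A / fine d)%R _ (leey _)); last by rewrite divr_ge0// ltW.
by rewrite -dE -EFinM divfK ?gt_eqF.
Qed.

Lemma normX_Mplus F : Mplus F -> normX rho F = rho F.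
Proof.
move=> MF; apply/esym/(norm_eq hrho) => //.
by move=> x Ix; rewrite gee0_abs//; exact: MF.2.
Qed.

Lemma Mplus_dilation (s : R) F : (0 < s)%R -> Mplus F -> Mplus (dilation s F).
Proof.
move=> s0 [mF F0].
have sub t : (0 < t < Num.min 1 s)%R -> I (t / s)%R.
  move=> /andP[t0]; rewrite lt_min => /andP[_ ts].
  by rewrite /I01/= in_itv/= divr_gt0//= ltr_pdivrMr// mul1r.
split; last by move=> t _; rewrite /dilation; case: ifPn => // /sub; exact: F0.
pose D := `]0%R, (Num.min 1 s)%R[%classic.
have -> : dilation s F = (fun t => F (t / s)%R) \_ D.
  by apply/funext => t; rewrite /dilation patchE mem_setE/= inE.
apply: (@measurable_funS _ _ _ _ setT) => //.
apply/(measurable_restrictT _ _).1 => //; first exact: measurable_itv.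
apply: (@measurable_comp _ _ _ _ _ _ I F D (fun t => t / s)%R).
- exact: measurable_I01.
- by move=> _ [t + <-]; rewrite /D/= in_itv/=; exact: sub.
- exact: mF.
- exact: mulrr_measurable.
Qed.

(** The operator norm is a supremum over the unit ball; homogeneity extends
    the estimate to all F, including those of norm zero. *)
Lemma norm_dilation_le (s h : R) F : (0 < s)%R -> (0 < h)%R ->
  dilation_norm rho s <= h%:E -> Mplus F ->
  rho (dilation s F) <= h%:E * rho F.
Proof.
move=> s0 h0 sh MF.
have := bfn_ge0 hrho MF; case E : (rho F) => [a| |]// a0; last first.
  by rewrite gt0_muley ?lte_fin// leey.
rewrite lee_fin in a0.
apply/lee_addgt0Pr => e e0.
(* F is normalized by slightly more than its norm, which may be 0. *)
pose c := (a + e / h)%R.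
have c0 : (0 < c)%R by rewrite ltr_wpDl// divr_gt0.
have cV0 : (0 <= c^-1)%R by rewrite invr_ge0 ltW.
pose cF x := c^-1%:E * F x.
have McF : Mplus cF by exact: MplusZ.
have : normX rho (dilation s cF) <= h%:E.
  apply: le_trans sh; apply: ereal_sup_ubound; exists cF => //.
  split; first exact: McF.1.
  rewrite normX_Mplus// (bfnZ hrho)// E -EFinM lee_fin.
  by rewrite ler_pdivrMl// mulr1 lerDl divr_ge0// ltW.
rewrite normX_Mplus; last exact: Mplus_dilation.
rewrite (@norm_eq _ _ hrho _ (fun x => c^-1%:E * dilation s F x)); last 2 first.
- exact: Mplus_dilation.
- by move=> x _; rewrite /dilation; case: ifPn => // _; rewrite mule0.
rewrite (bfnZ hrho)//; last exact: Mplus_dilation.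
rewrite lee_pdivrMl// => /le_trans; apply.
by rewrite -EFinM -EFinD lee_fin mulrDl divfK ?gt_eqF// mulrC.
Qed.

End Dilation.

(** * Stretching nonincreasing functions *)

Section StepFunctions.
Variable R : realType.
Variable rho : (R -> \bar R) -> \bar R.
Hypothesis hX : ri_norm rho.
Let hrho : banach_function_norm rho := hX.1.
Implicit Types F G H : R -> \bar R.
Local Notation mu := (@lebesgue_measure R).
Local Notation I := (I01 R).
Local Open Scope ereal_scope.
Hint Resolve measurable_I01 : core.

(** Rearrangement invariance, in terms of distribution functions. *)
Lemma norm_equimeasurable F G : Mplus F -> Mplus G ->
  (forall x, I x -> F x \is a fin_num) -> (forall x, I x -> G x \is a fin_num) ->
  (forall lam : R, (0 < lam)%R -> mu [set x | I x /\ lam%:E < F x] =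
    mu [set x | I x /\ lam%:E < G x]) ->
  rho F = rho G.
Proof.
move=> MF MG fF fG FG.
have absE H : Mplus H -> forall lam : R,
    [set x | I x /\ lam%:E < `|H x|] = [set x | I x /\ lam%:E < H x].
  move=> MH lam; have HE x : I x -> `|H x| = H x.
    by move=> Ix; rewrite gee0_abs// MH.2.
  by apply/seteqP; split => x [Ix] lx; split; rewrite ?HE// in lx *.
rewrite -(normX_Mplus hrho MF) -(normX_Mplus hrho MG); apply: hX.2.
- by split; [exact: MF.1|exact: aeI].
- by split; [exact: MG.1|exact: aeI].
move=> s _; rewrite /rearr; congr (ereal_inf (_ @` _)).
by apply/seteqP; split => t /= [t0]; rewrite !absE// FG.
Qed.

(** The value c k on P k, and 0 elsewhere, when the P k are disjoint. A series
    rather than a case distinction, so that measurability is immediate. *)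
Definition stepfun (c : nat -> R) (P : nat -> set R) (x : R) : \bar R :=
  \sum_(k <oo) (c k * \1_(P k) x)%:E.

Lemma stepfun_in (c : nat -> R) (P : nat -> set R) k x : (forall k, 0 <= c k)%R ->
  trivIset setT P -> P k x -> stepfun c P x = (c k)%:E.
Proof.
move=> c0 tP Px; rewrite /stepfun (@nneseriesD1 _ _ k)//; last first.
  by move=> i _; rewrite lee_fin mulr_ge0.
rewrite indicE mem_set// mulr1 eseries0 ?adde0// => i _ /andP[_ ik].
rewrite indicE memNset ?mulr0// => Pi; move/eqP: ik; apply.
by apply: tP => //; exists x.
Qed.

Lemma stepfun_out (c : nat -> R) (P : nat -> set R) x :
  (forall k, ~ P k x) -> stepfun c P x = 0.
Proof.
by move=> nP; apply: eseries0 => i _ _; rewrite indicE memNset ?mulr0.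
Qed.

Lemma Mplus_stepfun (c : nat -> R) (P : nat -> set R) : (forall k, 0 <= c k)%R ->
  (forall k, measurable (P k)) -> Mplus (stepfun c P).
Proof.
move=> c0 mP; apply: Mplus_series => k.
split; last by move=> x _; rewrite lee_fin mulr_ge0.
apply/measurable_EFinP/measurable_funM => //.
Qed.

Lemma mu_stepfun_superlevel (c : nat -> R) (P : nat -> set R) (lam : R) :
  (forall k, 0 <= c k)%R -> (forall k, measurable (P k)) -> trivIset setT P ->
  (forall k, P k `<=` I) -> (0 < lam)%R ->
  mu [set x | I x /\ lam%:E < stepfun c P x] =
  \sum_(k <oo | k \in [set k | (lam < c k)%R]) mu (P k).
Proof.
move=> c0 mP tP PI lam0.
rewrite -measure_bigcup; [|by move=> k _; exact: mP|exact: sub_trivIset tP].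
congr (mu _); apply/seteqP; split => x /=.
  move=> [Ix]; have [[k Pk]|nP] := pselect (exists k, P k x).
    by rewrite (stepfun_in c0 tP Pk) lte_fin => lc; exists k.
  rewrite stepfun_out; first by rewrite lte_fin ltNge (ltW lam0).
  by move=> k Pk; apply: nP; exists k.
move=> [k /= lc Pk]; split; first exact: PI Pk.
by rewrite (stepfun_in c0 tP Pk) lte_fin.
Qed.

(** Step functions with the same values on disjoint pieces of the same
    measures are equimeasurable. *)
Lemma norm_stepfun (c : nat -> R) (P Q : nat -> set R) :
  (forall k, 0 <= c k)%R -> (forall k, measurable (P k)) -> trivIset setT P ->
  (forall k, P k `<=` I) -> (forall k, measurable (Q k)) -> trivIset setT Q ->
  (forall k, Q k `<=` I) -> (forall k, mu (P k) = mu (Q k)) ->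
  rho (stepfun c P) = rho (stepfun c Q).
Proof.
move=> c0 mP tP PI mQ tQ QI PQ.
have fin S : trivIset setT S -> forall x, stepfun c S x \is a fin_num.
  move=> tS x; have [[k Sk]|nS] := pselect (exists k, S k x).
    by rewrite (stepfun_in c0 tS Sk).
  by rewrite stepfun_out// => k Sk; apply: nS; exists k.
apply: norm_equimeasurable.
- exact: Mplus_stepfun.
- exact: Mplus_stepfun.
- by move=> x _; exact: fin.
- by move=> x _; exact: fin.
move=> lam lam0; rewrite !mu_stepfun_superlevel//.
by apply: eq_eseriesr => k _.
Qed.

End StepFunctions.

Section Stretching.
Variable R : realType.
Variable rho : (R -> \bar R) -> \bar R.
Hypothesis hX : ri_norm rho.
Let hrho : banach_function_norm rho := hX.1.
Implicit Types F G H : R -> \bar R.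
Local Notation mu := (@lebesgue_measure R).
Local Notation I := (I01 R).
Hint Resolve measurable_I01 : core.

(** A nonincreasing H stretched by b^n is at most a sum of b^(n+1) functions,
    each equimeasurable with a function below H. To see this, cut every
    geometric interval J k into b^(n+1) equal pieces P j k; on J k the
    stretched function is at most its value c k at the left end of J k. For
    fixed j, the step function with values c k on the P j k is equimeasurable
    with the one on the intervals Q k = J k / b^(n+1), and on Q k the function
    H is still at least c k. This is the bound on stretching that
    interpolation between L^1 and L^infinity would give, up to a constant. *)
Lemma norm_stretch_le (b n : nat) H : (1 < b)%N ->
  (forall x, I x -> H x \is a fin_num) -> (forall x, I x -> 0 <= H x)%E ->
  (forall s t, I s -> I t -> s <= t -> (H t <= H s)%E) ->
  (rho (fun t => H (t * b%:R ^- n)%R) <= (b%:R ^+ n.+1)%:E * rho H)%E.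
Proof.
move=> b1 fH H0 nH; pose B : R := b%:R.
have B1 : 1 < B by rewrite ltr1n.
have B0 : 0 < B by rewrite (lt_trans _ B1).
have BV m : 0 < B ^- m by rewrite invr_gt0 exprn_gt0.
have Bn1 m : B ^- m <= 1 by rewrite invf_le1 ?exprn_gt0// exprn_ege1// ltW.
have MH : Mplus H.
  by split => //; apply: emeasurable_nonincreasing => //; exact: interval_is_interval.
(* The number of pieces: b^n for the stretching, and one more factor b for
   replacing H by its largest value on each J k. *)
pose M := (b ^ n.+1)%N.
have ME : M%:R = B ^+ n.+1 by rewrite /M natrX.
pose J k := `[B ^- k.+1, B ^- k[%classic : set R.
have tJ : trivIset setT J.
  have := geometric_piece_trivIset B1 ltr01.
  by under [X in trivIset _ X]eq_fun do rewrite !mul1r.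
have JI k : J k `<=` I.
  move=> x; rewrite /J /I01/= !in_itv/= => /andP[kx xk].
  by rewrite (lt_le_trans (BV _) kx)/= (lt_le_trans xk).
pose l k := (B ^- k - B ^- k.+1) / B ^+ n.+1.
have Bdec k : B ^- k.+1 < B ^- k.
  by rewrite ltf_pV2 ?posrE ?exprn_gt0// ltr_eXn2l.
have l0 k : 0 < l k by rewrite divr_gt0 ?exprn_gt0// subr_gt0.
pose P j k := `[B ^- k.+1 + j%:R * l k, B ^- k.+1 + j.+1%:R * l k[%classic : set R.
pose Q k := `[B ^- n.+1 * B ^- k.+1, B ^- n.+1 * B ^- k[%classic : set R.
have PJ j : (j < M)%N -> forall k, P j k `<=` J k.
  move=> jM k x; rewrite /P /J/= !in_itv/= => /andP[jx xj].
  rewrite (le_trans _ jx)/=; last by rewrite lerDl mulr_ge0// ltW.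
  rewrite (lt_le_trans xj)// -lerBrDl.
  have -> : B ^- k - B ^- k.+1 = M%:R * l k.
    by rewrite ME /l mulrC divfK// gt_eqF// exprn_gt0.
  by rewrite ler_pM2r// ler_nat.
have tQ : trivIset setT Q by exact: geometric_piece_trivIset.
have QI k : Q k `<=` I.
  move=> x; rewrite /Q /I01/= !in_itv/= => /andP[kx xk].
  rewrite (lt_le_trans _ kx) ?mulr_gt0//= (lt_le_trans xk)//.
  by rewrite mulr_ile1// ltW.
have BI m x : I x -> I (x * B ^- m) by apply: scale_I01; rewrite BV Bn1.
pose a k := B ^- k.+1 * B ^- n.
have aI k : I (a k).
  apply: BI; rewrite /I01/= in_itv/= BV (lt_le_trans (Bdec _))//.
pose c k := fine (H (a k)).
have c0 k : 0 <= c k by rewrite fine_ge0// H0.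
have cE k : (c k)%:E = H (a k) by rewrite fineK// fH.
have mP j k : measurable (P j k) by exact: measurable_itv.
have mQ k : measurable (Q k) by exact: measurable_itv.
have muPQ j k : mu (P j k) = mu (Q k).
  rewrite !mu_itvco; last 2 first.
  - by rewrite ler_pM2l// ltW.
  - by rewrite lerD2l ler_pM2r// ler_nat.
  congr (_%:E); rewrite /l -[j.+1]addn1 natrD; ring.
have Qle : (rho (stepfun c Q) <= rho H)%E.
  apply: (norm_le hrho) => //; first exact: Mplus_stepfun.
  move=> x Ix; have [[k Qx]|nQ] := pselect (exists k, Q k x).
    rewrite (stepfun_in c0 tQ Qx) cE; apply: nH => //.
    move: Qx; rewrite /Q /a/= in_itv/= => /andP[_ /ltW /le_trans]; apply.
    by rewrite !exprS !invfM le_eqVlt; apply/orP; left; apply/eqP; ring.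
  by rewrite stepfun_out ?H0// => k Qx; apply: nQ; exists k.
have Pj j : (j < M)%N -> (rho (stepfun c (P j)) <= rho H)%E.
  move=> jM; have tP : trivIset setT (P j) := sub_trivIset_pointwise (PJ _ jM) tJ.
  rewrite (norm_stepfun hX c0 (mP j) tP _ mQ tQ QI (muPQ j))//.
  by move=> k; apply: subset_trans (JI k); exact: PJ.
(* For j >= M the value is a default, chosen so that S j is measurable. *)
pose S j := stepfun c (if (j < M)%N then P j else Q).
have MS j : Mplus (S j) by rewrite /S; case: ifP => _; exact: Mplus_stepfun.
apply: (@le_trans _ _ (rho (fun x => \sum_(0 <= j < M) S j x)%E)).
  apply: (norm_le hrho).
  - split; last first.
      by move=> x Ix; apply/H0/BI.
    apply: emeasurable_nonincreasing; first exact: interval_is_interval.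
    by move=> s t Is It st; apply: nH; [exact: BI|exact: BI|rewrite ler_pM2r].
  - exact: Mplus_sum.
  - move=> x Ix; have [k] : exists k, J k x.
      have := exists_geometric_piece B1 Ix.
      by move=> [k]; rewrite !mul1r => kx; exists k; rewrite /J/= in_itv.
    rewrite /J/= in_itv/= => /andP[kx xk].
    pose j := Num.truncn ((x - B ^- k.+1) / l k).
    have : 0 <= (x - B ^- k.+1) / l k by rewrite divr_ge0 ?subr_ge0// ltW.
    move=> /truncn_itv; rewrite -/j => /andP[jx xj].
    have Px : P j k x.
      rewrite /P/= in_itv/= -lerBrDl -ler_pdivlMr// jx/=.
      by rewrite -ltrBlDl -ltr_pdivrMr.
    have jM : (j < M)%N.
      rewrite -(ltr_nat R) ME (le_lt_trans jx)// ltr_pdivrMr//.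
      rewrite /l mulrC divfK ?gt_eqF ?exprn_gt0//.
      by rewrite ltrD2r.
    rewrite big_mkord (bigD1 (Ordinal jM))//= {1}/S jM.
    have tP : trivIset setT (P j) := sub_trivIset_pointwise (PJ _ jM) tJ.
    rewrite (stepfun_in c0 tP Px) cE.
    apply: (@le_trans _ _ (H (a k))).
      apply: nH => //; first exact: BI.
      by rewrite /a ler_pM2r.
    rewrite leeDl//; apply: sume_ge0 => i _; exact: (MS i).2.
apply: le_trans (norm_sum hrho _ MS) _.
rewrite -ME.
rewrite (@le_trans _ _ (\sum_(0 <= j < M) rho H)%E)//.
  rewrite !big_mkord; apply: lee_sum => j _.
  by rewrite /S ltn_ord; exact: Pj.
by rewrite big_mkord sumr_const card_ord mule_natl.
Qed.

End Stretching.

(** * Geometric decay from the indices *)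

Section Indices.
Variable R : realType.
Local Notation I := (I01 R).

(** A limit that does not exist is 0 by convention, so a nonzero limit is a
    true limit. This applies to all the indices, which are positive. *)
Lemma cvg_lim_neq0 (F : set_system R) (u : R -> R) : lim (u x @[x --> F]) != 0 ->
  u x @[x --> F] --> lim (u x @[x --> F]).
Proof.
move=> ul; have [//|/dvgP ul0] := pselect (cvg (u x @[x --> F])).
by move: ul; rewrite ul0 eqxx.
Qed.

(** The quotient also excludes an infinite E: the real part of +oo is 0 and
    the logarithm of 0 is 0, which would make the quotient 0. *)
Lemma le_powR_of_ln_gt (E : \bar R) (a s : R) : 0 < a -> 0 < s < 1 ->
  a < ln (fine E) / ln s -> (E <= (s `^ a)%:E)%E.
Proof.
move=> a0 /andP[s0 s1]; have ls : ln s < 0 by rewrite ln_lt0// s0.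
rewrite ltr_ndivlMr// => h.
have lE : ln (fine E) < 0 by rewrite (lt_trans h)// pmulr_rlt0.
have E0 : 0 < fine E.
  by rewrite ltNge; apply/negP => /ln0 lE0; rewrite lE0 ltxx in lE.
case: E h lE E0 => [e| |]//= h _ e0; rewrite ?ltxx// in e0 *.
by rewrite lee_fin -ler_ln ?posrE ?powR_gt0// ln_powR ltW.
Qed.

Lemma le_powR_of_ln_lt (E : \bar R) (a s : R) : 1 < s ->
  (E < +oo)%E -> ln (fine E) / ln s < a -> (E <= (s `^ a)%:E)%E.
Proof.
move=> s1; have ls : 0 < ln s by rewrite ln_gt0.
case: E => [e| |]//= _; last by rewrite leNye.
rewrite ltr_pdivrMr// => h; rewrite lee_fin.
have [e0|e0] := leP e 0; first by rewrite (le_trans e0)// powR_ge0.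
by rewrite -ler_ln ?posrE ?powR_gt0 ?(lt_trans _ s1)// ln_powR ltW.
Qed.

Lemma near_at_right_inv (P : R -> Prop) : (\forall s \near (0 : R)^'+, P s) ->
  exists A : R, forall x, A < x -> 0 < x -> P x^-1.
Proof.
move=> [e /= e0 eP]; exists e^-1 => x ex x0.
apply: eP; rewrite /= ?invr_gt0//.
by rewrite sub0r normrN gtr0_norm ?invr_gt0// -[ltRHS]invrK ltf_pV2 ?posrE ?invr_gt0.
Qed.

Variable psi : R -> R.
Hypothesis hpsi : classA0 psi.
Variable rho : (R -> \bar R) -> \bar R.
Hypothesis hindex : upper_fund_index psi < lower_boyd_index rho.
Implicit Types F G : R -> \bar R.

(** The indices only control the behaviour at 0 and at infinity; a large ratio
    b moves all the scales b^k with k > 0 into that range. In particular the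
    index itself makes the dilation norms finite at these scales. *)
Lemma geometric_decay : exists b : nat, exists q : R,
  [/\ (1 < b)%N, 0 < q < 1,
    forall k, (0 < k)%N -> exists h, exists m : R,
      [/\ 0 < h, 0 < m, (dilation_norm rho (b%:R ^- k) <= h%:E)%E,
          (mfun_sup psi (b%:R ^+ k) <= m%:E)%E & m * h <= q ^+ (2 * k)] &
    forall k, (0 < k)%N -> (mfun_sup psi (b%:R ^- k) <= (q ^+ k)%:E)%E].
Proof.
have lo := A0_lower_gt0 hpsi.
have up := A0_lower_le_upper hpsi.
have up0 := lt_le_trans lo up.
have bo0 := lt_trans up0 hindex.
set bt := upper_fund_index psi in up up0 *.
set al := lower_boyd_index rho in bo0 *.
set de := lower_fund_index psi in lo up *.
(* A third of the gap is lost on each index, and the last third is the decay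
   rate of the product. *)
pose e := (al - bt) / 3.
have e0 : 0 < e by rewrite divr_gt0// subr_gt0; exact: hindex.
have alE : al = bt + 3 * e by rewrite /e; field.
have eal : 0 < al - e by rewrite alE; lra.
have [hB hL hU] : [/\
  \forall s \near (0:R)^'+, al - e < ln (fine (dilation_norm rho s)) / ln s,
  \forall s \near (0:R)^'+, de / 2 < ln (fine (mfun_sup psi s)) / ln s &
  \forall s \near +oo, ln (fine (mfun_sup psi s)) / ln s < bt + e].
  split.
  - have := @cvg_lim_neq0 _ _ (lt0r_neq0 bo0); move/cvgr_gt; apply.
    by rewrite -/al ltrBlDr ltrDl.
  - have := @cvg_lim_neq0 _ _ (lt0r_neq0 lo); move/cvgr_gt; apply.
    by rewrite -/de ltr_pdivrMr// ltr_pMr// ltr1n.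
  - have := @cvg_lim_neq0 _ _ (lt0r_neq0 up0); move/cvgr_lt; apply.
    by rewrite -/bt ltrDl.
have [b [b1 hb]] : exists b : nat, (1 < b)%N /\ forall x : R, b%:R <= x ->
  [/\ (dilation_norm rho x^-1 <= (x^-1 `^ (al - e))%:E)%E,
      (mfun_sup psi x^-1 <= (x^-1 `^ (de / 2))%:E)%E &
      (mfun_sup psi x <= (x `^ (bt + e))%:E)%E].
  have [A1 hA1] := near_at_right_inv hB.
  have [A2 hA2] := near_at_right_inv hL.
  case: hU => A3 [_ hA3].
  pose b := (Num.truncn A1 + Num.truncn A2 + Num.truncn A3).+2.
  exists b; split => // x bx.
  have big A : (Num.truncn A < b)%N -> A < x.
    by move=> Ab; rewrite (lt_le_trans _ bx)// (lt_le_trans (truncnS_gt A))// ler_nat.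
  have x1 : 1 < x by rewrite (lt_le_trans _ bx)// ltr1n.
  have x0 : 0 < x := lt_trans ltr01 x1.
  have xV : 0 < x^-1 < 1 by rewrite invr_gt0 x0 invf_lt1.
  split.
  - apply: le_powR_of_ln_gt => //.
    by apply/hA1/x0/big; rewrite ltnS leqW// -addnA leq_addr.
  - apply: le_powR_of_ln_gt => //; last first.
      by apply/hA2/x0/big; rewrite ltnS leqW// addnAC leq_addl.
    by rewrite divr_gt0.
  - apply: le_powR_of_ln_lt => //; first exact: (A0_fin hpsi).
    by apply/hA3/big; rewrite ltnS leqW// leq_addl.
pose B : R := b%:R.
have B1 : 1 < B by rewrite ltr1n.
have B0 : 0 < B := lt_trans ltr01 B1.
pose eta := Num.min (e / 2) (de / 2).
have eta0 : 0 < eta by rewrite lt_min (divr_gt0 e0)// (divr_gt0 lo).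
have BX (k : nat) (c : R) : (B ^+ k) `^ c = B `^ (k%:R * c).
  by rewrite -powR_mulrn ?ltW// powRrM.
have BV (k : nat) (c : R) : (B ^- k) `^ c = B `^ (- (k%:R * c)).
  by rewrite -powR_inv1 ?exprn_ge0 ?ltW// -powRrM BX mulN1r mulrN.
have qX k : (B `^ (- eta)) ^+ k = B `^ (- (k%:R * eta)).
  by rewrite -powR_mulrn ?powR_ge0// -powRrM mulrC mulrN.
have bB k : (0 < k)%N -> b%:R <= B ^+ k.
  by move=> k0; rewrite -/B -[leLHS]expr1 ler_eXn2l.
exists b, (B `^ (- eta)); split => //.
- rewrite powR_gt0//= powRN invf_lt1 ?powR_gt0//.
  by rewrite -ltr_ln ?posrE ?powR_gt0// ln1 ln_powR mulr_gt0// ln_gt0.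
- move=> k k0; have [h _ m] := hb _ (bB _ k0).
  exists ((B ^- k) `^ (al - e)), ((B ^+ k) `^ (bt + e)).
  split; rewrite ?powR_gt0 ?invr_gt0 ?exprn_gt0//.
  rewrite BX BV -powRD; last by apply/implyP => _; rewrite gt_eqF.
  rewrite qX ler_powR ?(ltW B1)//.
  have etae : eta <= e / 2 by rewrite ge_min lexx.
  rewrite natrM alE; have h' := ler_wpM2l (ler0n R k) etae; lra.
- move=> k k0; have [_ h _] := hb _ (bB _ k0).
  apply: le_trans h _; rewrite lee_fin BV qX ler_powR ?(ltW B1)// lerN2.
  by rewrite ler_wpM2l// ge_min lexx orbT.
Qed.

End Indices.

Section WeightedDilation.
Variable R : realType.
Variable psi : R -> R.
Hypothesis hpsi : classA0 psi.
Variable rho : (R -> \bar R) -> \bar R.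
Hypothesis hrho : banach_function_norm rho.
Hypothesis hindex : upper_fund_index psi < lower_boyd_index rho.
Implicit Types F G : R -> \bar R.
Local Notation I := (I01 R).

Lemma Mplus_inv_psi : Mplus (fun t => (psi t)^-1%:E).
Proof.
split; last by move=> t It; rewrite lee_fin invr_ge0 ltW// (A0_gt0 hpsi).
apply: emeasurable_nonincreasing; first exact: interval_is_interval.
move=> s t Is It st; rewrite lee_fin lef_pV2 ?posrE ?(A0_gt0 hpsi)//.
exact: (A0_nondecreasing hpsi).
Qed.

Lemma psi_le_mfun_sup (s t m : R) : I s -> I (s * t) ->
  (mfun_sup psi t <= m%:E)%E -> psi (s * t) <= m * psi s.
Proof.
move=> Is Ist tm; rewrite -ler_pdivrMr ?(A0_gt0 hpsi)// -lee_fin.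
apply: le_trans tm; apply: ereal_sup_ubound; exists s => //.
by move: Is Ist; rewrite /I01/= !in_itv/= => -> /andP[].
Qed.

(** Passing the weight through the dilation costs the supremum of psi (t / s)
    / psi t. *)
Lemma norm_weighted_dilation_le (s h m : R) F : 0 < s < 1 -> 0 < h -> 0 < m ->
  (dilation_norm rho s <= h%:E)%E -> (mfun_sup psi s^-1 <= m%:E)%E -> Mplus F ->
  (rho (fun t => (psi t)^-1%:E * dilation s F t) <=
   (m * h)%:E * rho (fun t => (psi t)^-1%:E * F t))%E.
Proof.
move=> /andP[s0 s1] h0 m0 sh sm MF; have Mpsi := Mplus_inv_psi.
have MG := MplusM Mpsi MF.
rewrite EFinM -muleA.
apply: (@le_trans _ _
  (m%:E * rho (dilation s (fun t => (psi t)^-1%:E * F t)))%E); last first.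
  by rewrite lee_pmul2l//; exact: norm_dilation_le.
rewrite -(bfnZ hrho) ?(ltW m0)//; last exact: Mplus_dilation.
apply: (norm_le hrho).
- by apply: MplusM => //; exact: Mplus_dilation.
- by apply: MplusZ; [exact: ltW|exact: Mplus_dilation].
move=> t It; rewrite /dilation; case: ifPn => [/andP[t0 ts]|]; last by rewrite !mule0.
have Its : I (t / s)%R.
  move: ts; rewrite lt_min => /andP[_ ts].
  by rewrite /I01/= in_itv/= divr_gt0//= ltr_pdivrMr// mul1r.
rewrite muleA -EFinM lee_wpmul2r ?MF.2// lee_fin.
have p1 := A0_gt0 hpsi It; have p2 := A0_gt0 hpsi Its.
rewrite -[leLHS]div1r ler_pdivrMr// mulrAC ler_pdivlMr// mul1r.
exact: psi_le_mfun_sup.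
Qed.

(** The form in which the hypothesis on the indices is used: compressing by
    b^k makes weighted norms decay geometrically, and psi itself decays along
    the scale. Half of the decay pays for the weights of the power of a sum.
    *)
Lemma weighted_dilation_decay : exists b : nat, exists q : R,
  [/\ (1 < b)%N, 0 < q < 1,
    forall k F, Mplus F ->
      (rho (fun t => (psi t)^-1%:E * dilation (b%:R ^- k) F t) <=
       (q ^+ (2 * k))%:E * rho (fun t => (psi t)^-1%:E * F t))%E &
    forall k t, I t -> psi (t * b%:R ^- k) <= q ^+ k * psi t].
Proof.
have [b [q [b1 q01 hmb psib]]] := geometric_decay hpsi hindex.
have B1 : (1 : R) < b%:R by rewrite ltr1n.
have B0 : (0 : R) < b%:R := lt_trans ltr01 B1.
have Mpsi := Mplus_inv_psi.
exists b, q; split => //.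
- move=> k F MF; have MG := MplusM Mpsi MF.
  case: k => [|k].
    rewrite muln0 expr0 mul1e invr1.
    rewrite (norm_eq hrho (G := fun t => ((psi t)^-1%:E * F t)%E))//.
      by apply: MplusM => //; exact: Mplus_dilation.
    move=> t; rewrite /I01/= in_itv/= => t01.
    by rewrite /dilation minxx t01 divr1.
  have [h [m [h0 m0 hk mk qk]]] := hmb k.+1 (ltn0Sn k).
  have s01 : 0 < (b%:R ^- k.+1 : R) < 1.
    by apply/andP; split; rewrite ?invr_gt0 ?exprn_gt0// invf_lt1 ?exprn_gt0// exprn_egt1.
  have := norm_weighted_dilation_le s01 h0 m0 hk; rewrite invrK => /(_ _ mk MF).
  move/le_trans; apply; apply: lee_wpmul2r; first exact: (bfn_ge0 hrho).
  by rewrite lee_fin.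
- case=> [|k] t It; first by rewrite expr0 invr1 mulr1 mul1r.
  apply: psi_le_mfun_sup => //; last exact: psib.
  apply: scale_I01 => //.
  by rewrite invr_gt0 exprn_gt0//= invf_le1 ?exprn_gt0// exprn_ege1// ltW.
Qed.

End WeightedDilation.

(** * Weighted norm inequalities *)

Section WeightedNorm.
Variable R : realType.
Variable psi : R -> R.
Hypothesis hpsi : classA0 psi.
Variable rho : (R -> \bar R) -> \bar R.
Hypothesis hX : ri_norm rho.
Hypothesis hindex : upper_fund_index psi < lower_boyd_index rho.
Let hrho : banach_function_norm rho := hX.1.
Implicit Types f g F G : R -> \bar R.
Local Notation mu := (@lebesgue_measure R).
Local Notation I := (I01 R).
Local Open Scope ereal_scope.
Hint Resolve measurable_I01 : core.
Local Notation wnorm F := (rho (fun t => (psi t)^-1%:E * F t)).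

Let Mpsi : Mplus (fun t => (psi t)^-1%:E) := Mplus_inv_psi hpsi.

Lemma wnorm_le F G : Mplus F -> Mplus G -> (forall x, I x -> F x <= G x) ->
  wnorm F <= wnorm G.
Proof.
move=> MF MG FG; apply: (norm_le hrho); [exact: MplusM|exact: MplusM|].
move=> x Ix; apply: lee_wpmul2l; [exact: Mpsi.2|exact: FG].
Qed.

Lemma wnormZ (a : R) F : (0 <= a)%R -> Mplus F ->
  wnorm (fun t => a%:E * F t) = a%:E * wnorm F.
Proof.
move=> a0 MF; rewrite -(bfnZ hrho)//; last exact: MplusM.
by congr rho; apply/funext => t; rewrite muleCA.
Qed.

Lemma wnormD F G : Mplus F -> Mplus G ->
  wnorm (fun t => F t + G t) <= wnorm F + wnorm G.
Proof.
move=> MF MG; apply: le_trans (bfnD hrho (MplusM Mpsi MF) (MplusM Mpsi MG)).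
rewrite (norm_eq hrho (G := fun x => (psi x)^-1%:E * F x + (psi x)^-1%:E * G x))//.
  by apply: MplusM => //; exact: MplusD.
by move=> x Ix; rewrite ge0_muleDr//; [exact: MF.2|exact: MG.2].
Qed.

Lemma wnorm_ge0 F : Mplus F -> 0 <= wnorm F.
Proof. by move=> MF; apply: (bfn_ge0 hrho); exact: MplusM. Qed.

Lemma wnorm_series (s : nat -> R -> \bar R) (q : R) (a : \bar R) :
  (0 < q < 1)%R -> 0 <= a -> (forall k, Mplus (s k)) ->
  (forall k, wnorm (s k) <= (q ^+ k)%:E * a) ->
  wnorm (fun x => \sum_(k <oo) s k x) <= (1 - q)^-1%:E * a.
Proof.
move=> q01 a0 Ms sa.
rewrite (norm_eq hrho (G := fun x => \sum_(k <oo) (psi x)^-1%:E * s k x)).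
- apply: (norm_series hrho) => // k; exact: MplusM.
- by apply: MplusM => //; exact: Mplus_series.
- by move=> x Ix; rewrite nneseriesZl// => k _; exact: (Ms k).2.
Qed.

(** The norm of 1 / psi is finite: the constant 1 is dominated by the sum of
    the compressed copies of the indicator of [1/b, 1), where psi is bounded
    below. *)
Lemma wnorm1_lty : wnorm (fun=> 1) < +oo.
Proof.
have [b [q [b1 /andP[q0 q1] dil _]]] :=
  weighted_dilation_decay hpsi hrho hindex.
set B : R := b%:R in dil.
have B1 : (1 < B)%R by rewrite ltr1n.
have B0 : (0 < B)%R := lt_trans ltr01 B1.
have bI : I (B^-1)%R.
  by rewrite /I01/= in_itv/= invr_gt0 B0 invf_lt1.
(* Every x in (0,1) is brought into E by exactly one power of B. *)
pose E := `[(B^-1)%R, 1%R[%classic : set R.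
have mE : measurable E by exact: measurable_itv.
have ME := Mplus_indic mE.
have BV k : (0 < (B ^- k))%R by rewrite invr_gt0 exprn_gt0.
have Mdil k : Mplus (dilation (B ^- k)%R (fun x => (\1_E x)%:E)).
  exact: Mplus_dilation.
apply: (@le_lt_trans _ _
  ((1 - q)^-1%:E * ((psi (B^-1)%R)^-1%:E * rho (fun=> 1)))); last first.
  have f1 : rho (fun=> 1) \is a fin_num.
    by rewrite ge0_fin_numE ?norm_cst1_lty// (bfn_ge0 hrho)//; exact: Mplus_cst.
  by rewrite -(fineK f1) -!EFinM ltry.
apply: (@le_trans _ _ (wnorm (fun x =>
    \sum_(k <oo) dilation (B ^- k)%R (fun x => (\1_E x)%:E) x))).
  apply: wnorm_le; [exact: Mplus_cst|exact: Mplus_series|] => x Ix.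
  have x01 : (0 < x < 1)%R by move: Ix; rewrite /I01/= in_itv.
  have [k] := exists_geometric_piece B1 x01; rewrite !mul1r => /andP[kx xk].
  rewrite (@nneseriesD1 _ _ k)//; last by move=> i _; exact: (Mdil i).2.
  have -> : dilation (B ^- k)%R (fun x => (\1_E x)%:E) x = 1.
    rewrite /dilation min_r; last by rewrite invf_le1 ?exprn_gt0// exprn_ege1// ltW.
    have := x01 => /andP[-> _]; rewrite xk/= indicE mem_set//.
    rewrite /E/= in_itv/= invrK; apply/andP; split.
      by rewrite -ler_pdivrMr ?exprn_gt0// -invfM -exprS.
    by rewrite -ltr_pdivlMr ?exprn_gt0// mul1r.
  by rewrite leeDl// nneseries_ge0// => i _ _; exact: (Mdil i).2.
have a0 : 0 <= (psi (B^-1)%R)^-1%:E * rho (fun=> 1).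
  by apply: mule_ge0; [exact: Mpsi.2|apply: (bfn_ge0 hrho); exact: Mplus_cst].
apply: wnorm_series => //; first by rewrite q0.
move=> k; apply: le_trans (dil k _ ME) _.
apply: (@le_trans _ _ ((q ^+ k)%:E * wnorm (fun x => (\1_E x)%:E))).
  apply: lee_wpmul2r; first exact: wnorm_ge0.
  by rewrite lee_fin ler_wiXn2l ?ltW// leq_pmull.
apply: lee_wpmul2l; first by rewrite lee_fin exprn_ge0// ltW.
rewrite -(bfnZ hrho); last 2 first.
- by have := Mpsi.2 _ bI; rewrite lee_fin.
- exact: Mplus_cst.
apply: (norm_le hrho).
- exact: MplusM.
- by apply: MplusZ; [have := Mpsi.2 _ bI; rewrite lee_fin|exact: Mplus_cst].
move=> x Ix; rewrite indicE; case: (boolP (x \in E)) => [|_]; last first.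
  by rewrite mule0 mule1; exact: Mpsi.2.
rewrite inE /E/= in_itv/= => /andP[bx _]; rewrite !mule1 lee_fin.
by rewrite lef_pV2 ?posrE ?(A0_gt0 hpsi)// (A0_nondecreasing hpsi).
Qed.

Lemma Mplus_rearr f : Mplus (rearr f).
Proof. by split; [exact: measurable_rearr|move=> *; exact: rearr_ge0]. Qed.

Lemma Mplus_maxrearr f : Mplus (maxrearr f).
Proof.
split; first exact: measurable_maxrearr.
by move=> x /I01_gt0/ltW; exact: maxrearr_ge0.
Qed.

Lemma Mplus_osc g : L0 g -> Mplus (fun t => maxrearr g t - rearr g t).
Proof.
move=> Lg; split; last by move=> x /I01_gt0; exact: osc_ge0.
apply: emeasurable_funB; first exact: measurable_maxrearr.
exact: measurable_rearr.
Qed.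

(** The main inequality. The maximal function is at most a sum of compressed
    copies of u = (b - 1) (Mg - Rg) + b J, with J the integral of Rg. Taking
    the power 1/r costs q^-k on the k-th copy, the weighted dilation gains
    q^(2 k), and the remaining series converges. *)
Lemma wnorm_maxrearr_le_osc (r : R) : (0 < r)%R -> exists2 c : R, (0 < c)%R &
  forall g, L0 g ->
  wnorm (fun t => maxrearr g t `^ r^-1) <=
  c%:E * (wnorm (fun t => (maxrearr g t - rearr g t) `^ r^-1) +
          (\int[mu]_(x in `]0%R, 1%R[) rearr g x) `^ r^-1).
Proof.
move=> r0; set p := r^-1%R; have p0 : (0 < p)%R by rewrite invr_gt0.
have [b [q [b1 /andP[q0 q1] dil _]]] :=
  weighted_dilation_decay hpsi hrho hindex.
set B : R := b%:R in dil.
have B1 : (1 < B)%R by rewrite ltr1n.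
have B0 : (0 < B)%R := lt_trans ltr01 B1.
have B10 : (0 < B - 1)%R by rewrite subr_gt0.
have BV k : (0 < (B ^- k : R))%R by rewrite invr_gt0 exprn_gt0.
pose th := ((1 - q `^ r) `^ (- p))%R.
have th0 : (0 < th)%R.
  rewrite powR_gt0// subr_gt0; have := gt0_ltr_powR r0 _ _ q1.
  by rewrite powR1; apply; rewrite nnegrE// ltW.
have q1' : (0 < 1 - q)%R by rewrite subr_gt0.
pose N := fine (wnorm (fun=> 1)).
have M1 : Mplus (fun _ : R => 1%E) by exact: Mplus_cst.
have N0 : (0 <= N)%R by rewrite fine_ge0// wnorm_ge0.
have NE : N%:E = wnorm (fun=> 1).
  by rewrite fineK// ge0_fin_numE ?wnorm1_lty// wnorm_ge0.
have N1 : (0 < 1 + N)%R by rewrite ltr_wpDr.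
have c0 : (0 < (1 - q)^-1 * (th * (2 `^ p * (B `^ p * (1 + N)))))%R.
  apply: mulr_gt0; first by rewrite invr_gt0.
  by apply: mulr_gt0 => //; do 2 (apply: mulr_gt0; first by rewrite powR_gt0).
exists ((1 - q)^-1 * (th * (2 `^ p * (B `^ p * (1 + N)))))%R => //.
move=> g Lg; set J := \int[mu]_(x in _) _.
set O := fun x => maxrearr g x - rearr g x.
have J0 : 0 <= J by exact: integral_rearr_ge0.
have MO : Mplus O by exact: Mplus_osc.
have [Jfin|] := ltP J +oo; last first.
  rewrite leye_eq => /eqP ->; rewrite poweRyr ?gt_eqF//.
  rewrite addey; last first.
    by rewrite gt_eqF// (lt_le_trans _ (wnorm_ge0 (Mplus_poweR p MO)))// ltNye.
  by rewrite gt0_muley ?leey// lte_fin.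
(* The summand B J covers the last scale, where the recursion stops. *)
pose u x := (B - 1)%:E * O x + B%:E * J.
have Mu : Mplus u.
  apply: MplusD; first by apply: MplusZ => //; exact: ltW.
  by apply: Mplus_cst; rewrite mule_ge0// lee_fin ltW.
have Mup := Mplus_poweR p Mu.
have Md k F : Mplus F -> Mplus (dilation (B ^- k) F) by exact: Mplus_dilation.
pose s k x := (th * q ^- k)%:E * dilation (B ^- k) (fun x => u x `^ p) x.
have thq k : (0 <= th * q ^- k)%R.
  by rewrite mulr_ge0 ?invr_ge0 ?exprn_ge0 ?(ltW th0) ?(ltW q0).
have Ms k : Mplus (s k) by apply: MplusZ => //; exact: Md.
have step1 : wnorm (fun t => maxrearr g t `^ p) <=
    wnorm (fun x => \sum_(k <oo) s k x).
  apply: wnorm_le;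
    [exact/Mplus_poweR/Mplus_maxrearr|exact: Mplus_series|] => x Ix.
  have x01 : (0 < x < 1)%R by move: Ix; rewrite /I01/= in_itv.
  have [n] := exists_geometric_piece B1 x01; rewrite !mul1r => /andP[nx _].
  have := @maxrearr_le_dilation_sum _ B g n x Lg B1 Jfin Ix.
  rewrite -ler_pdivrMl ?exprn_gt0// mulr1 => /(_ nx).
  rewrite -/J -/u => h.
  have h1 : maxrearr g x <= \sum_(0 <= k < n.+1) dilation (B ^- k) u x.
    apply: le_trans h; rewrite leeDl// mule_ge0//; first by rewrite lee_fin ltW.
    exact: MO.2.
  have h2 := ler_poweR (ltW p0) ((Mplus_maxrearr g).2 _ Ix) h1.
  apply: le_trans h2 _.
  have q01 : (0 < q < 1)%R by rewrite q0.
  have := poweR_sum_le n.+1 q01 r0 (fun k => (Md k _ Mu).2 _ Ix).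
  move=> /le_trans; apply; apply: lee_nneseries => k _.
    by move=> _; rewrite mule_ge0 ?poweR_ge0// lee_fin.
  rewrite lee_wpmul2l ?lee_fin// /dilation; case: ifP => // _.
  by rewrite poweR0r ?gt_eqF.
apply: le_trans step1 _.
have step2 : wnorm (fun x => \sum_(k <oo) s k x) <=
    (1 - q)^-1%:E * (th%:E * wnorm (fun x => u x `^ p)).
  apply: wnorm_series => //; first by rewrite q0.
    by rewrite mule_ge0 ?wnorm_ge0// lee_fin ltW.
  move=> k; rewrite wnormZ//; last exact: Md.
  apply: (@le_trans _ _ ((th * q ^- k)%:E *
      ((q ^+ (2 * k))%:E * wnorm (fun x => u x `^ p)))).
    by rewrite lee_wpmul2l ?lee_fin// dil.
  rewrite !muleA -!EFinM lee_wpmul2r ?wnorm_ge0// lee_fin.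
  rewrite mul2n -addnn exprD (mulrC th) -mulrA (mulrC th) -!mulrA.
  by rewrite mulKf// gt_eqF// exprn_gt0.
apply: le_trans step2 _.
have c1 : (0 <= (1 - q)^-1)%R by rewrite invr_ge0 ltW.
rewrite !EFinM -!muleA.
do 2 (apply: lee_wpmul2l; first by rewrite lee_fin// ltW).
have step3 : wnorm (fun x => u x `^ p) <=
    wnorm (fun x => (2 `^ p)%R%:E * ((B `^ p)%R%:E * (O x `^ p + J `^ p))).
  apply: wnorm_le => //.
    apply: MplusZ; first exact: powR_ge0.
    apply: MplusZ; first exact: powR_ge0.
    by apply: MplusD; [exact: Mplus_poweR|apply: Mplus_cst; exact: poweR_ge0].
  move=> x Ix; rewrite -poweR_EFin.
  apply: le_trans (poweR_add_le (ltW p0) _ _) _.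
  - by rewrite mule_ge0 ?lee_fin ?(ltW B10)//; exact: MO.2.
  - by rewrite mule_ge0 ?lee_fin ?(ltW B0).
  rewrite poweR_EFin lee_wpmul2l ?lee_fin ?powR_ge0//.
  rewrite -poweR_EFin [leRHS]ge0_muleDr ?poweR_ge0//.
  rewrite -!poweRM ?lee_fin ?(ltW B0)//; last exact: MO.2.
  rewrite leeD2r// ler_poweR ?(ltW p0)//.
    by rewrite mule_ge0 ?lee_fin ?(ltW B10)//; exact: MO.2.
  by rewrite lee_wpmul2r ?lee_fin; [|exact: MO.2|rewrite lerBlDr lerDl].
apply: le_trans step3 _.
have MOp := Mplus_poweR p MO.
have MJ : Mplus (fun _ : R => J `^ p) by apply: Mplus_cst; exact: poweR_ge0.
have MOJ := MplusD MOp MJ.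
rewrite wnormZ ?powR_ge0//; last by apply: MplusZ => //; exact: powR_ge0.
rewrite wnormZ ?powR_ge0//.
do 2 (apply: lee_wpmul2l; first by rewrite lee_fin powR_ge0).
apply: le_trans (wnormD MOp MJ) _.
have Jf : J `^ p \is a fin_num by rewrite fin_num_poweR// ge0_fin_numE.
have -> : wnorm (fun=> J `^ p) = J `^ p * N%:E.
  rewrite -(fineK Jf) NE -wnormZ//; last by rewrite fine_ge0// poweR_ge0.
  by congr rho; apply/funext => x; rewrite mule1.
have w0 : 0 <= wnorm (fun x => O x `^ p) by exact: wnorm_ge0.
rewrite ge0_muleDr ?poweR_ge0//; apply: leeD.
  by rewrite -[leLHS]mul1e lee_wpmul2r// lee_fin lerDl.
by rewrite muleC lee_wpmul2r ?poweR_ge0// lee_fin lerDr.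
Qed.

Lemma wnorm_osc_le_maxrearr (p : R) g : (0 <= p)%R -> L0 g ->
  wnorm (fun t => (maxrearr g t - rearr g t) `^ p) <=
  wnorm (fun t => maxrearr g t `^ p).
Proof.
move=> p0 Lg; have MO := Mplus_osc Lg.
apply: wnorm_le; [exact: Mplus_poweR|exact/Mplus_poweR/Mplus_maxrearr|].
move=> x Ix; apply: ler_poweR => //; first exact: MO.2.
rewrite leeBlDr; last exact: (rearr_fin_num Lg (I01_gt0 Ix)).
by rewrite leeDl// rearr_ge0.
Qed.

(** On (0, 1/2) the maximal function is at least the full integral and 1 / psi
    is at least 1 / psi (1/2). *)
Lemma integral_rearr_le_wnorm (p : R) : (0 < p)%R -> exists2 c : R, (0 < c)%R &
  forall g, (\int[mu]_(x in `]0%R, 1%R[) rearr g x) `^ p <=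
    c%:E * wnorm (fun t => maxrearr g t `^ p).
Proof.
move=> p0; pose E := `]0%R, 2^-1%R[%classic : set R.
have mE : measurable E by exact: measurable_itv.
have h2 : (0 < (2^-1 : R) < 1)%R by lra.
have hI : I (2^-1)%R by rewrite /I01/= in_itv.
have EI : E `<=` I.
  move=> x; rewrite /E /I01/= !in_itv/= => /andP[-> x2]/=.
  by rewrite (lt_trans x2)//; case/andP: h2.
have E0 : 0 < mu E.
  rewrite /E lebesgue_measure_itv/= lte_fin; case/andP: h2 => h2 _.
  by rewrite h2 oppr0 adde0 lte_fin.
set d := rho (fun x => (\1_E x)%:E).
have d0 : 0 < d := norm_indic_gt0 hrho mE EI E0.
have dE : (fine d)%:E = d.
  by rewrite fineK// ge0_fin_numE ?(bfn_indic hrho mE EI)// ltW.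
have fd0 : (0 < fine d)%R by rewrite -lte_fin dE.
have psi0 := A0_gt0 hpsi hI.
exists (psi 2^-1 / fine d)%R; first by rewrite divr_gt0.
move=> g; set J := \int[mu]_(x in _) _.
have J0 : 0 <= J by exact: integral_rearr_ge0.
have Mg := Mplus_poweR p (Mplus_maxrearr g).
have : ((psi 2^-1)^-1%:E * J `^ p) * d <= wnorm (fun t => maxrearr g t `^ p).
  apply: (norm_ge_indic hrho) => //.
  - by rewrite mule_ge0 ?poweR_ge0// lee_fin invr_ge0 ltW.
  - exact: MplusM.
  move=> x Ex; have Ix := EI _ Ex.
  apply: lee_pmul; rewrite ?poweR_ge0 ?lee_fin ?invr_ge0 ?(ltW psi0)//.
  - rewrite lef_pV2 ?posrE ?(A0_gt0 hpsi)// (A0_nondecreasing hpsi)//.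
    by move: Ex; rewrite /E/= in_itv/= => /andP[_ /ltW].
  - apply: ler_poweR => //; first exact: ltW.
    apply: integral_rearr_le_maxrearr.
    by move: Ix; rewrite /I01/= in_itv.
have -> : (psi 2^-1 / fine d = ((psi 2^-1)^-1 * fine d)^-1)%R by rewrite invfM invrK.
rewrite lee_pdivlMl; last by rewrite mulr_gt0 ?invr_gt0.
by rewrite -dE muleAC -EFinM.
Qed.

(** Hardy's inequality for nonincreasing functions. The k-th scale contributes
    b^-k from its length, q^k from the decay of psi and b^k from the
    stretching of the nonincreasing function Rf / psi, so that a geometric
    series in q remains. *)
Lemma wnorm_maxrearr_le_rearr : exists2 c : R, (0 < c)%R &
  forall f, L0 f -> wnorm (maxrearr f) <= c%:E * wnorm (rearr f).
Proof.
have [b [q [b1 /andP[q0 q1] _ psib]]] :=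
  weighted_dilation_decay hpsi hrho hindex.
set B : R := b%:R in psib.
have B1 : (1 < B)%R by rewrite ltr1n.
have B0 : (0 < B)%R := lt_trans ltr01 B1.
have q1' : (0 < 1 - q)%R by rewrite subr_gt0.
exists ((1 - q)^-1 * B ^+ 2)%R; first by rewrite mulr_gt0 ?invr_gt0 ?exprn_gt0.
move=> f Lf; have Mf := Mplus_rearr f.
pose H t := (psi t)^-1%:E * rearr f t.
have MH : Mplus H by exact: MplusM.
have fH x : I x -> H x \is a fin_num.
  by move=> Ix; rewrite fin_numM// (rearr_fin_num Lf (I01_gt0 Ix)).
have nH s t : I s -> I t -> (s <= t)%R -> H t <= H s.
  move=> Is It st; apply: lee_pmul; [exact: Mpsi.2|exact: rearr_ge0| |].
    by rewrite lee_fin lef_pV2 ?posrE ?(A0_gt0 hpsi)// (A0_nondecreasing hpsi).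
  exact: rearr_nonincreasing.
have BI n x : I x -> I (x * B ^- n)%R.
  apply: scale_I01; rewrite invr_gt0 exprn_gt0//= invf_le1 ?exprn_gt0//.
  by rewrite exprn_ege1// ltW.
have MHn n : Mplus (fun t => H (t * B ^- n)%R).
  split; last by move=> x Ix; exact/MH.2/BI.
  apply: emeasurable_nonincreasing; first exact: interval_is_interval.
  move=> s t Is It st; apply: nH; [exact: BI|exact: BI|].
  by rewrite ler_pM2r// invr_gt0 exprn_gt0.
have coef_ge0 k : (0 <= (B - 1) * B ^- k.+1)%R.
  by rewrite mulr_ge0 ?invr_ge0 ?exprn_ge0 ?(ltW B0)// subr_ge0 ltW.
(* The k-th scale: its share in the integral, times the decay of psi. *)
pose c k := ((B - 1) * B ^- k.+1 * q ^+ k.+1)%R.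
have c0 k : (0 <= c k)%R.
  by rewrite mulr_ge0 ?exprn_ge0 ?(ltW q0).
pose s k t := (c k)%:E * H (t * B ^- k.+1)%R.
have Ms k : Mplus (s k) by exact: MplusZ.
rewrite EFinM -muleA.
apply: (@le_trans _ _ (rho (fun t => \sum_(k <oo) s k t))).
  apply: (norm_le hrho).
  - by apply: MplusM => //; exact: Mplus_maxrearr.
  - exact: Mplus_series.
  move=> t It; have pt := A0_gt0 hpsi It.
  have h := maxrearr_le_series f B1 (I01_gt0 It).
  apply: (le_trans (lee_wpmul2l (Mpsi.2 _ It) h)).
  rewrite -nneseriesZl; last first.
    by move=> k _; rewrite mule_ge0 ?rearr_ge0// lee_fin.
  apply: lee_nneseries => [k _ _|k _].
    rewrite mule_ge0//; first exact: Mpsi.2.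
    by rewrite mule_ge0 ?rearr_ge0// lee_fin.
  rewrite /s /H !muleA; apply: lee_wpmul2r; first exact: rearr_ge0.
  rewrite -!EFinM lee_fin /c mulrC -!mulrA.
  apply: ler_wpM2l; first by rewrite subr_ge0 ltW.
  apply: ler_wpM2l; first by rewrite invr_ge0 exprn_ge0// ltW.
  have ptn := A0_gt0 hpsi (BI k.+1 _ It).
  by rewrite -[leLHS]mul1r ler_pdivrMr// mulrAC ler_pdivlMr// mul1r psib.
apply: (norm_series hrho); rewrite ?q0//.
  by rewrite mule_ge0 ?(bfn_ge0 hrho)// lee_fin exprn_ge0// ltW.
move=> k; rewrite (bfnZ hrho)//.
apply: (@le_trans _ _ ((c k)%:E * ((B ^+ k.+2)%:E * rho H))).
  apply: lee_wpmul2l; first by rewrite lee_fin.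
  by apply: (norm_stretch_le hX) => // x; exact: MH.2.
rewrite !muleA -!EFinM; apply: lee_wpmul2r; first exact: (bfn_ge0 hrho).
rewrite lee_fin /c.
have -> : ((B - 1) / B ^+ k.+1 * q ^+ k.+1 * B ^+ k.+2 =
    q ^+ k * (B * (B - 1) * q))%R.
  have Bk : (B ^+ k.+1 != 0)%R by rewrite gt_eqF// exprn_gt0.
  by rewrite (exprS B k.+1) (exprS q k); field.
rewrite ler_wpM2l ?exprn_ge0 ?(ltW q0)//; nra.
Qed.

End WeightedNorm.

(** * The equivalences *)

Section Equivalences.
Variable R : realType.
Variable psi : R -> R.
Hypothesis hpsi : classA0 psi.
Variable rho : (R -> \bar R) -> \bar R.
Hypothesis hX : ri_norm rho.
Hypothesis hindex : upper_fund_index psi < lower_boyd_index rho.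
Let hrho : banach_function_norm rho := hX.1.
Implicit Types f F : R -> \bar R.
Local Notation mu := (@lebesgue_measure R).
Local Notation I := (I01 R).
Local Open Scope ereal_scope.
Local Notation wnorm F := (rho (fun t => (psi t)^-1%:E * F t)).

Lemma normX_weight F : Mplus F ->
  normX rho (fun t => F t * (psi t)^-1%:E) = wnorm F.
Proof.
move=> MF; rewrite (_ : (fun t => _) = fun t => (psi t)^-1%:E * F t).
  by rewrite (normX_Mplus hrho)//; exact: (MplusM (Mplus_inv_psi hpsi)).
by apply/funext => t; rewrite muleC.
Qed.

Lemma normLrE (r : R) f : measurable_fun I f ->
  normLr r f = (\int[mu]_(x in `]0%R, 1%R[) rearr (abspow r f) x) `^ r^-1.
Proof.
move=> mf; rewrite /normLr -integral_rearr; last exact: measurable_abspow.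
by congr (_ `^ _); apply: eq_integral => x _; rewrite [RHS]gee0_abs ?abspow_ge0.
Qed.

Lemma osc_normE (r : R) f : L0 f -> osc_norm rho psi r f =
  wnorm (fun t => (maxrearr (abspow r f) t - rearr (abspow r f) t) `^ r^-1) +
  (\int[mu]_(x in `]0%R, 1%R[) rearr (abspow r f) x) `^ r^-1.
Proof.
move=> Lf; rewrite /osc_norm normLrE; last exact: Lf.1.
by rewrite normX_weight//; apply/Mplus_poweR/Mplus_osc/L0_abspow.
Qed.

Lemma max_normE (r : R) f :
  max_norm rho psi r f = wnorm (fun t => maxrearr (abspow r f) t `^ r^-1).
Proof. by rewrite /max_norm normX_weight//; exact/Mplus_poweR/Mplus_maxrearr. Qed.

Lemma max_norm1E f : max_norm1 rho psi f = wnorm (maxrearr f).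
Proof. by rewrite /max_norm1 normX_weight//; exact: Mplus_maxrearr. Qed.

Lemma simeq_of_le (A B : (R -> \bar R) -> \bar R) (c1 c2 : R) :
  (0 < c1)%R -> (0 < c2)%R ->
  (forall f, L0 f -> 0 <= A f /\ 0 <= B f) ->
  (forall f, L0 f -> A f <= c1%:E * B f) ->
  (forall f, L0 f -> B f <= c2%:E * A f) -> simeq A B.
Proof.
move=> c10 c20 AB0 AB BA; have c0 : (0 < Num.max c1 c2)%R by rewrite lt_max c10.
exists (Num.max c1 c2) => // f Lf; have [A0 B0] := AB0 _ Lf; split.
  rewrite lee_pdivrMl//; apply: le_trans (AB _ Lf) _.
  by rewrite lee_wpmul2r// lee_fin le_max lexx.
apply: le_trans (BA _ Lf) _.
by rewrite lee_wpmul2r// lee_fin le_max lexx orbT.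
Qed.

Lemma simeq_finite_space (A B : (R -> \bar R) -> \bar R) : simeq A B ->
  finite_space A = finite_space B.
Proof.
move=> [c c0 AB]; apply/seteqP; split => f [Lf fin]; split => //;
  have [AB1 AB2] := AB _ Lf.
- by apply: le_lt_trans AB2 _; rewrite lte_mul_pinfty ?lee_fin ?(ltW c0).
- have := le_lt_trans AB1 fin; rewrite lte_pdivrMl// => /lt_le_trans; apply.
  exact: leey.
Qed.

Lemma simeq_osc_max (r : R) : (0 < r)%R ->
  simeq (osc_norm rho psi r) (max_norm rho psi r).
Proof.
move=> r0; have p0 : (0 < r^-1)%R by rewrite invr_gt0.
have [c1 c10 h1] := integral_rearr_le_wnorm hpsi hX p0.
have [c2 c20 h2] := wnorm_maxrearr_le_osc hpsi hX hindex r0.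
have wO f : L0 f -> 0 <= wnorm (fun t =>
    (maxrearr (abspow r f) t - rearr (abspow r f) t) `^ r^-1).
  by move=> Lf; apply: (wnorm_ge0 hpsi hX); apply/Mplus_poweR/Mplus_osc/L0_abspow.
have wM f : 0 <= wnorm (fun t => maxrearr (abspow r f) t `^ r^-1).
  by apply: (wnorm_ge0 hpsi hX); apply/Mplus_poweR/Mplus_maxrearr.
apply: (@simeq_of_le _ _ (1 + c1) c2) => // [|f Lf|f Lf|f Lf].
- by rewrite addr_gt0.
- by rewrite osc_normE// max_normE; split; [rewrite adde_ge0 ?poweR_ge0 ?wO|exact: wM].
- rewrite osc_normE// max_normE EFinD ge0_muleDl ?lee_fin ?(ltW c10)//.
  rewrite mul1e; apply: leeD; last exact: h1.
  exact: (wnorm_osc_le_maxrearr hpsi hX (ltW p0) (L0_abspow r Lf)).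
- rewrite osc_normE// max_normE; exact: (h2 _ (L0_abspow r Lf)).
Qed.

(** One direction is Jensen's inequality; the other one bounds Rf by the power
    1/r of the maximal function of |f|^r and applies Hardy's inequality to Rf.
    *)
Lemma simeq_max_max1 (r : R) : (0 < r <= 1)%R ->
  simeq (max_norm rho psi r) (max_norm1 rho psi).
Proof.
move=> r01; have r0 : (0 < r)%R by case/andP: r01.
have p0 : (0 < r^-1)%R by rewrite invr_gt0.
have [c c0 h] := wnorm_maxrearr_le_rearr hpsi hX hindex.
have Mg f : Mplus (fun t => maxrearr (abspow r f) t `^ r^-1).
  exact/Mplus_poweR/Mplus_maxrearr.
have Mf f := Mplus_maxrearr f.
have c20 : (0 < 2 `^ r^-1 :> R)%R by rewrite powR_gt0.
apply: (@simeq_of_le _ _ (2 `^ r^-1)%R c) => // [f Lf|f Lf|f Lf];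
  rewrite max_normE max_norm1E.
- by split; apply: (wnorm_ge0 hpsi hX).
- rewrite -(wnormZ hpsi hX) ?(ltW c20)//; apply: (wnorm_le hpsi hX) => //.
    by apply: MplusZ => //; exact: ltW.
  move=> x Ix; apply: maxrearr_abspow_le => //; [exact: Lf.1|exact: I01_gt0].
- apply: le_trans (h _ Lf) _; apply: lee_wpmul2l; first by rewrite lee_fin ltW.
  apply: (wnorm_le hpsi hX) => //; first exact: Mplus_rearr.
  move=> x Ix; rewrite -[leLHS](@poweRrK _ r) ?gt_eqF ?rearr_ge0//.
  apply: ler_poweR; [exact: ltW|exact: poweR_ge0|].
  rewrite -rearr_abspow//; last exact: Lf.1.
  by apply: rearr_le_maxrearr; exact: I01_gt0.
Qed.

End Equivalences.

Theorem theorem9 (R : realType) (psi : R -> R)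
    (X : (R -> \bar R) -> \bar R) (hpsi : classA0 psi) (hX : ri_norm X)
    (hindex : upper_fund_index psi < lower_boyd_index X) :
  (forall r : R, 0 < r <= 1 ->
     simeq (osc_norm X psi r) (max_norm X psi r) /\
     simeq (max_norm X psi r) (max_norm1 X psi)) /\
  (forall r r' : R, 0 < r <= 1 -> 0 < r' <= 1 ->
     finite_space (osc_norm X psi r) = finite_space (osc_norm X psi r') /\
     finite_space (max_norm X psi r) = finite_space (max_norm X psi r')).
Proof.
have osc r : 0 < r <= 1 -> simeq (osc_norm X psi r) (max_norm X psi r).
  by move=> /andP[r0 _]; exact: simeq_osc_max.
have max1 r : 0 < r <= 1 -> simeq (max_norm X psi r) (max_norm1 X psi).
  exact: simeq_max_max1.
split=> [r r01|r r' r01 r'01]; first by split; [exact: osc|exact: max1].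
have oscE s (s01 : 0 < s <= 1) := simeq_finite_space (osc s s01).
have maxE s (s01 : 0 < s <= 1) := simeq_finite_space (max1 s s01).
by rewrite !oscE// !maxE.
Qed.
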